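(* Let $V\subset\mathbb{C}^N$ be an algebraic curve satisfying properties (i)–(iii) of the context, and let $K\subset V$ be a compact set. List the monomials $\{z^\alpha: z^\alpha\notin\langle\mathrm{lt}(\mathbf I(V))\rangle\}$ in grevlex order as $\{z^{\alpha_j}\}_{j=1}^\infty$ (so $z^{\alpha_1}=1$), put $\mathrm{Van}(\zeta_1,\dots,\zeta_n)=\det\bigl(z^{\alpha_i}(\zeta_j)\bigr)_{i,j=1}^n$, and for a positive integer $n$ put $$\tilde V_n=\sup\{|\mathrm{Van}(\zeta_1,\dots,\zeta_{m_n})|:\{\zeta_1,\dots,\zeta_{m_n}\}\subset K\}.$$ Then $\lim_{n\to\infty}\tilde V_n^{1/l_n}=d(K)$, where $d(K)$ is the transfinite diameter of $K$ defined in the context.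
   Context: Algebra. $N>1$, $z=(z_1,\dots,z_N)$. An algebraic curve $V\subset\mathbb{C}^N$ is a nonempty algebraic variety whose Hilbert polynomial has degree 1 (at all but finitely many points it is a complex manifold of dimension 1). $\mathbf I(V)$ is the ideal of polynomials vanishing on $V$. The grevlex order is: $z^\alpha\prec z^\beta$ if $|\alpha|<|\beta|$, or $|\alpha|=|\beta|$ and for some $i$, $\alpha_i>\beta_i$ and $\alpha_j=\beta_j$ for all $j<i$ (so $z_1\prec z_2\prec\cdots\prec z_N$). With $\langle \mathrm{lt}(I)\rangle$ the ideal generated by the leading terms of elements of $I=\mathbf I(V)$, put $\mathcal B=\{z^\alpha: z^\alpha\notin\langle \mathrm{lt}(I)\rangle\}$. Every polynomial $p$ equals on $V$ a unique linear combination $\rho_V(p)$ of elements of $\mathcal B$ (its normal form). $\mathbb{C}[V]$ denotes the linear span of $\mathcal B$ in $\mathbb{C}[z]$, with product $p*q=\rho_V(pq)$; $\deg$ is the total degree; $\mathbb{C}[V]_{=n}$ is the space of homogeneous polynomials of degree $n$ in $\mathbb{C}[V]$ (with $0$), $\mathbb{C}[V]_{\le n}$ the space of elements of degree $\le n$; $\hat p$ is the leading homogeneous part of $p$. Geometry. $\mathbb{C}^N\subset\mathbb{CP}^N=\mathbb{C}^N\cup H_\infty$ via $(z_1,\dots,z_N)\mapsto[1:z_1:\cdots:z_N]$, $H_\infty=\{z_0=0\}$; $V$ also denotes the projective closure of $V$ (smallest projective variety containing it). Properties: (i) $V\cap H_\infty\subset\{z_1\ne0\}$; (ii) the points of $V\cap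 H_\infty$ are nonsingular on $V$ and all intersections with $H_\infty$ are transverse (the tangent line to $V$ is not contained in $H_\infty$); (iii) two distinct points $[0:1:\lambda_{12}:\cdots:\lambda_{1N}]$, $[0:1:\lambda_{22}:\cdots:\lambda_{2N}]$ of $V\cap H_\infty$ satisfy $\lambda_{1j}\neq\lambda_{2j}$ for all $j=2,\dots,N$. Write $V\cap H_\infty=\{\lambda_1,\dots,\lambda_d\}$; then $\dim\mathbb{C}[V]_{=n}=d$ for all large $n$. For homogeneous $p$ and $\lambda=[0:1:\lambda_2:\cdots:\lambda_N]$, $p(\lambda):=p(1,\lambda_2,\dots,\lambda_N)$. Directional polynomials. For $\lambda\in V\cap H_\infty$, $\mathbf v_\lambda$ is the unique homogeneous polynomial in $\mathbb{C}[V]$ of minimal degree such that $\mathbf v_\lambda(\lambda)=1$; $\mathbf v_\lambda(w)=0$ for $w\in(V\cap H_\infty)\setminus\{\lambda\}$; and for every $p\in\mathbb{C}[V]$, $p*\mathbf v_\lambda=z_1^{\deg p}\hat p(\lambda)\mathbf v_\lambda+r$ with $r\in\mathbb{C}[V]$, $\deg r<\deg p+\deg\mathbf v_\lambda$ (identity of polynomials in $\mathbb{C}[V]$). For $s\ge\deg\mathbf v_\lambda$, $\mathbf v_{\lambda,s}:=z_1^{s-\deg\mathbf v_\lambda}\mathbf v_\lambda$. Transfinite diameter. Fix a positive integer $a\ge\max_j\deg\mathbf v_{\lambda_j}$, large enough that $\dim\mathbb{C}[V]_{=n}=d$ for all $n\ge a$. Let $\mathcal C$ consist of all $z^\alpha\in\mathcal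 B$ with $|\alpha|<a$ and all $\mathbf v_{\lambda_j,s}$ with $1\le j\le d$, $s\ge a$. List $\mathcal C$ as $e_1=1,e_2,e_3,\dots$ by increasing degree; within a given degree $<a$ use a graded order such as grevlex, and within a given degree $s\ge a$ put $\mathbf v_{\lambda_j,s}$ before $\mathbf v_{\lambda_k,s}$ if $j<k$. Set $\mathrm{Van}_{\mathcal C}(\zeta_1,\dots,\zeta_n)=\det(e_i(\zeta_j))_{i,j=1}^n$, $m_n=\dim\mathbb{C}[V]_{\le n}$, $l_n=\sum_{k=1}^n k(m_k-m_{k-1})$, and $V_n=\sup\{|\mathrm{Van}_{\mathcal C}(\zeta_1,\dots,\zeta_{m_n})|:\{\zeta_1,\dots,\zeta_{m_n}\}\subset K\}$. The transfinite diameter is $d(K)=\limsup_{n\to\infty}(V_n)^{1/l_n}$. *)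

(* Defs.v *)
From mathcomp Require Import all_boot all_order all_algebra.
From mathcomp Require Import mpoly complex.
From mathcomp Require Import boolp classical_sets constructive_ereal reals.
From mathcomp Require Import topology ereal normedtype sequences exp.
Set Implicit Arguments.
Unset Strict Implicit.
Unset Printing Implicit Defensive.
Import Order.TTheory GRing.Theory Num.Theory.
Import numFieldNormedType.Exports.
Local Open Scope classical_set_scope.
Local Open Scope ring_scope.

Section Dimension.
Context (K : fieldType) (M : lmodType K).

(* [k] is the dimension of W / (W `&` U), for subspaces W and U of M. *)
Definition has_dim_mod (W U : set M) (k : nat) : Prop :=
  exists b : 'I_k -> M,
    [/\ forall i, W (b i),
        forall c : 'I_k -> K, U (\sum_i c i *: b i) -> forall i, c i = 0
      & forall w, W w -> exists c : 'I_k -> K, U (w - \sum_i c i *: b i)].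

(* 0 if the dimension is infinite. *)
Definition dim_mod (W U : set M) : nat := xget 0%N (has_dim_mod W U).

Definition lin_dim (W : set M) : nat := dim_mod W [set 0].

End Dimension.

Section Monomials.
Context (N : nat).

(* The first variable is the smallest one. This is not the monomial order of
   multinomials. *)
Definition grevlex (alpha beta : 'X_{1..N}) : bool :=
  (mdeg alpha < mdeg beta)%N ||
  ((mdeg alpha == mdeg beta) &&
   [exists i : 'I_N, (beta i < alpha i)%N &&
     [forall j : 'I_N, (j < i)%N ==> (alpha j == beta j)]]).

Definition is_lead_term (K : fieldType) (p t : {mpoly K[N]}) : Prop :=
  exists2 m : 'X_{1..N}, m \in msupp p &
    (forall m', m' \in msupp p -> m' != m -> grevlex m' m) /\
    t = p@_m *: 'X_[m].

Definition generated_ideal (K : fieldType) (S : set {mpoly K[N]}) :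
    set {mpoly K[N]} :=
  [set p | exists s : seq ({mpoly K[N]} * {mpoly K[N]}),
     (forall x, x \in s -> S x.2) /\ p = \sum_(x <- s) x.1 * x.2].

End Monomials.

(* Total degree, with the convention deg 0 = 0. *)
Notation deg p := (msize p).-1.

Section Curves.
Context (R : realType) (N : nat).
Local Notation C := R[i].
(* Affine space of dimension N + 1; its coordinates z_1, ..., z_(N+1) have
   indices 0, ..., N. *)
Local Notation affine := 'rV[C]_N.+1.
Local Notation poly := {mpoly C[N.+1]}.
(* Projective points are given by nonzero vectors of homogeneous coordinates
   z_0, z_1, ..., z_(N+1); projective sets are stable under scaling. *)
Local Notation hcoords := 'rV[C]_(1 + N.+1).
Local Notation hpoly := {mpoly C[1 + N.+1]}.
Implicit Types (V K : set affine) (p q v : poly) (lam : affine).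

Definition eval_at (n : nat) (p : {mpoly C[n]}) (z : 'rV[C]_n) : C :=
  meval (fun i => z ord0 i) p.

Definition algebraic_set V : Prop :=
  exists s : seq poly, V = [set z : affine | forall p, p \in s -> eval_at p z = 0].

Definition vanishing_ideal V : set poly :=
  [set p | forall z, V z -> eval_at p z = 0].

Definition poly_le (n : nat) : set poly := [set p | (msize p <= n.+1)%N].

Definition hilbert_function V (n : nat) : nat :=
  dim_mod (poly_le n) (vanishing_ideal V).

Definition hilbert_polynomial V (h : {poly rat}) : Prop :=
  exists n0, forall n, (n0 <= n)%N -> h.[n%:R] = (hilbert_function V n)%:R.

Definition algebraic_curve V : Prop :=
  [/\ V !=set0, algebraic_set V &
      exists2 h, hilbert_polynomial V h & size h = 2%N].

Definition lead_ideal V : set poly :=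
  generated_ideal
    [set t | exists2 p, vanishing_ideal V p & is_lead_term p t].

Definition std_monomials V : set 'X_{1..N.+1} :=
  [set alpha | ~ lead_ideal V 'X_[alpha]].

(* The linear span of the standard monomials. *)
Definition coord_ring V : set poly :=
  [set p | forall m, m \in msupp p -> std_monomials V m].

Definition coord_ring_eq V (n : nat) : set poly :=
  coord_ring V `&` [set p | p \is n.-homog].

Definition coord_ring_le V (n : nat) : set poly :=
  coord_ring V `&` poly_le n.

Definition normal_form V p : poly :=
  xget 0 [set q | coord_ring V q /\
                  forall z, V z -> eval_at q z = eval_at p z].

Definition coord_mul V p q : poly := normal_form V (p * q).

(* [0 : z] and [1 : z] are the points at infinity and the affine points. *)
Definition hpoint (z0 : C) (z : affine) : hcoords := row_mx z0%:M z.

Definition projective_variety (W : set hcoords) : Prop :=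
  exists s : seq hpoly,
    (forall F, F \in s -> F \is (deg F).-homog) /\
    W = [set x : hcoords | x != 0 /\ forall F, F \in s -> eval_at F x = 0].

Definition projective_closure V : set hcoords :=
  smallest projective_variety [set hpoint 1 z | z in V].

(* Projective tangent space of the projective closure at x, as a linear
   subspace of the space of homogeneous coordinates. *)
Definition tangent_space V (x : hcoords) : set hcoords :=
  [set y : hcoords | forall (k : nat) (F : hpoly), F \is k.-homog ->
     (forall w, projective_closure V w -> eval_at F w = 0) ->
     \sum_i eval_at (mderiv i F) x * y ord0 i = 0].

(* The closure of a curve has local dimension 1 at its points at infinity, so
   such a point is nonsingular when its tangent space is a projective line. *)
Definition nonsingular_at V (x : hcoords) : Prop :=
  lin_dim (tangent_space V x) = 2%N.

Definition infinity_not_on_z1 V : Prop :=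
  forall z, projective_closure V (hpoint 0 z) -> z ord0 ord0 != 0.

Definition smooth_transverse_at_infinity V : Prop :=
  forall z, projective_closure V (hpoint 0 z) ->
    nonsingular_at V (hpoint 0 z) /\
    exists2 y, tangent_space V (hpoint 0 z) y & y ord0 ord0 != 0.

(* Vectors (1, lambda_2, ..., lambda_(N+1)) such that
   [0 : 1 : lambda_2 : ... : lambda_(N+1)] is on the projective closure. *)
Definition points_at_infinity V : set affine :=
  [set lam : affine | lam ord0 ord0 = 1 /\ projective_closure V (hpoint 0 lam)].

Definition distinct_slopes V : Prop :=
  forall l1 l2, points_at_infinity V l1 -> points_at_infinity V l2 ->
    l1 != l2 -> forall j : 'I_N.+1, j != ord0 -> l1 ord0 j != l2 ord0 j.

Definition lead_form p : poly := pihomog mdeg (deg p) p.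

Local Notation z1 := ('X_ord0 : poly).

(* For p != 0 the bound on r reads deg r < deg p + deg v, or r = 0. *)
Definition directional V lam v : Prop :=
  [/\ coord_ring V v, v \is (deg v).-homog, eval_at v lam = 1,
      forall w, points_at_infinity V w -> w != lam -> eval_at v w = 0
    & forall p, coord_ring V p -> exists r,
        [/\ coord_ring V r, (msize r <= deg p + deg v)%N &
            coord_mul V p v =
              eval_at (lead_form p) lam *: (z1 ^+ deg p * v) + r]].

Definition directional_poly V lam v : Prop :=
  directional V lam v /\ forall w, directional V lam w -> (deg v <= deg w)%N.

Definition raise v (s : nat) : poly := z1 ^+ (s - deg v) * v.

Section Basis.
Context (V : set affine) (d a : nat) (v : 'I_d -> poly).

Definition basisC : set poly :=
  [set 'X_[alpha] | alpha in std_monomials V `&` [set al | (mdeg al < a)%N]]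
  `|` [set p | exists j s, (a <= s)%N /\ p = raise (v j) s].

Definition basisC_lt p q : Prop :=
  (deg p < deg q)%N \/
  (deg p = deg q /\
   (((deg p < a)%N /\
     exists alpha beta, [/\ p = 'X_[alpha], q = 'X_[beta] & grevlex alpha beta])
    \/
    ((a <= deg p)%N /\
     exists j k, [/\ p = raise (v j) (deg p), q = raise (v k) (deg p)
                   & (j < k)%N]))).

(* [e i] is the (i + 1)-st element of the basis. *)
Definition basisC_listing (e : nat -> poly) : Prop :=
  range e = basisC /\ forall i j, (i < j)%N -> basisC_lt (e i) (e j).

End Basis.

(* [alpha i] is the exponent of the (i + 1)-st standard monomial. *)
Definition grevlex_listing V (alpha : nat -> 'X_{1..N.+1}) : Prop :=
  range alpha = std_monomials V /\
  forall i j, (i < j)%N -> grevlex (alpha i) (alpha j).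

Definition m_ V (n : nat) : nat := lin_dim (coord_ring_le V n).

Definition l_ V (n : nat) : nat :=
  (\sum_(1 <= k < n.+1) k * (m_ V k - m_ V k.-1))%N.

Definition vandermonde (e : nat -> poly) (n : nat) (zeta : 'I_n -> affine) : C :=
  \det (\matrix_(i < n, j < n) eval_at (e i) (zeta j)).

Definition max_vandermonde V (e : nat -> poly) K (n : nat) : R :=
  sup [set complex.Re `|vandermonde e zeta|
      | zeta in [set zeta : 'I_(m_ V n) -> affine | forall j, K (zeta j)]].

Definition vandermonde_root V (e : nat -> poly) K (n : nat) : \bar R :=
  (max_vandermonde V e K n `^ (l_ V n)%:R^-1)%:E.

Definition transfinite_diameter V (e : nat -> poly) K : \bar R :=
  limn_esup (vandermonde_root V e K).

(* The regular module C^o carries the usual topology of the complex numbers. *)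
Definition compact_set K : Prop := compact (K : set 'rV[C^o]_N.+1).

End Curves.

(* Main.v *)
Require Import Defs.
From mathcomp Require Import all_boot all_order all_algebra.
From mathcomp Require Import mpoly complex.
From mathcomp Require Import boolp classical_sets constructive_ereal reals.
From mathcomp Require Import topology ereal normedtype sequences exp.
From mathcomp Require Import ring lra zify.
Import Order.TTheory GRing.Theory Num.Theory.
Import numFieldNormedType.Exports.
Local Open Scope classical_set_scope.
Local Open Scope ring_scope.

(** Both Vandermonde maxima are governed by the same additive sequence, up to
    errors which the exponent 1/l_n, of size 1/n^2, makes invisible.

    Write W_k for the supremum over K of the Vandermonde determinant of the
    first k elements of the basis C, and T_k for the Chebyshev number: the least
    sup norm over K of e_k plus a combination of the earlier elements.
    Expanding determinants gives T_k W_k <= W_(k+1) <= (k+1) T_k W_k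
    ([sup_vdmS_ge], [sup_vdmS_le]), so ln W grows, over the d basis elements
    of degree s, by w(s) = sum_j ln T_(j,s), up to O(ln s).

    The directional polynomials diagonalise multiplication in top degree: on V,
    v_(j,s) v_(k,t) is v_(k,s+t) if j = k and 0 otherwise, up to lower degree
    ([raise_mul]).  Hence a product of monic combinations for (j,s) and (j,t)
    is one for (j,s+t), the numbers T_(j,s) are submultiplicative in s
    ([chebyshev_submul]) and w is subadditive.  By Fekete's lemma w(s)/s has a
    limit, possibly -oo; since l_n - l_(n-1) = d n, the Stolz-Cesaro argument
    gives the convergence of (ln W)/l_n ([weighted_fekete]), and exponentials
    turn the limit -oo into 0.

    It remains to compare the two bases.  Multiplication by z_1 maps the
    standard monomials of degree s >= a onto those of degree s + 1
    ([alpha_shift]), so that the d x d matrix which expresses v_(1,s), ...,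
    v_(d,s) in monomials is the same for all s ([block_coef_const]); it is
    invertible, its inverse being the table of values of the monomials at the
    points at infinity ([block_coef_eval]).  The quotient of the two Vandermonde
    determinants is therefore a geometric progression in the degree
    ([vdm_transition]): one more bounded error on the increments of ln W.

    If W_k vanishes for some k it vanishes from then on, and both limits
    are 0. *)

(** * Subadditive sequences and weighted means *)

(** One half of the Stolz-Cesaro theorem; applied to [- A] it gives the lower
    bound. *)
Lemma stolz_ub (R : realType) (A l : nat -> R) (n0 : nat) (c eps : R) :
  (forall n, (n0 <= n)%N -> A n.+1 - A n <= c * (l n.+1 - l n)) ->
  l n @[n --> \oo] --> +oo -> 0 < eps ->
  \forall n \near \oo, A n / l n <= c + eps.
Proof.
move=> hA hl e0.
have hD n : (n0 <= n)%N -> A n <= c * l n + (A n0 - c * l n0).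
  elim: n => [|n IH]; first by rewrite leqn0 => /eqP ->; lra.
  rewrite leq_eqVlt => /orP[/eqP -> |]; first by lra.
  by rewrite ltnS => hn; have := IH hn; have := hA n hn; lra.
set D := A n0 - c * l n0 in hD.
move/cvgryPge: hl => hl.
near=> n.
have hn : (n0 <= n)%N by near: n; exact: nbhs_infty_ge.
have l1 : 1 <= l n by near: n; exact: hl.
have l2 : D / eps <= l n by near: n; exact: hl.
rewrite ler_pdivrMr; last by apply: lt_le_trans l1.
move: l2; rewrite ler_pdivrMr // => l2.
by have := hD n hn; nra.
Unshelve. all: by end_near. Qed.

(** Fekete's estimate. Subtracting [s0] repeatedly leaves a remainder
    between [s0] and [2 s0], where subadditivity may still be used since [a <= s0]. *)
Lemma subadditive_affine_ub {R : realType} {w : nat -> R} {a s0 : nat} :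
  (0 < a)%N -> (forall s t, (a <= s)%N -> (a <= t)%N -> w (s + t)%N <= w s + w t) ->
  (a <= s0)%N ->
  exists B, forall s, (s0 <= s)%N -> w s <= w s0 / s0%:R * s%:R + B.
Proof.
move=> a0 hw hs0; set sg := w s0 / s0%:R.
have s00 : (0 < s0)%N by apply: leq_trans hs0.
have hsg : w s0 = sg * s0%:R by rewrite /sg divfK // pnatr_eq0 -lt0n.
pose B := \sum_(r < s0.*2) `|w r - sg * r%:R|.
exists B; elim/ltn_ind => s IH hs.
case: (ltnP s s0.*2) => hs2.
  have : `|w s - sg * s%:R| <= B.
    rewrite /B (bigD1 (Ordinal hs2)) //= lerDl; exact: sumr_ge0.
  by move=> /(le_trans (ler_norm _)); lra.
have h1 : (s0 <= s - s0)%N by lia.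
have h2 : (s - s0 < s)%N by lia.
have := IH _ h2 h1.
have := hw (s - s0)%N s0 (leq_trans hs0 h1) hs0.
rewrite subnK // hsg natrB //; lra.
Qed.

Lemma expR_cvg0 {R : realType} (x : nat -> R) :
  (forall M, \forall n \near \oo, x n <= M) -> expR (x n) @[n --> \oo] --> (0 : R).
Proof.
move=> h; apply/cvgrPdist_le => e e0; near=> n.
rewrite sub0r normrN ger0_norm ?expR_ge0 // -[leRHS]lnK // ler_expR.
by near: n; exact: h.
Unshelve. all: by end_near. Qed.

(** Fekete's lemma and the Stolz-Cesaro theorem combined. The limit [c] depends
    on [w] and [l] only: two sequences whose increments are both within
    [o(n)] of [w] have the same limit, which is how the two bases are compared.
    The exponential absorbs the case where [w s / s] tends to -oo. *)
Lemma weighted_fekete {R : realType} (w b l : nat -> R) (a : nat) (dl : R) :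
  (0 < a)%N -> 0 < dl ->
  (forall s t, (a <= s)%N -> (a <= t)%N -> w (s + t)%N <= w s + w t) ->
  (forall eps, 0 < eps -> \forall n \near \oo, b n <= eps * n%:R) ->
  (forall n, (a <= n)%N -> l n.+1 = l n + dl * n.+1%:R) ->
  exists c : R, forall A : nat -> R,
    (forall n, (a <= n)%N -> `|A n.+1 - A n - w n.+1| <= b n.+1) ->
    expR (A n / l n) @[n --> \oo] --> c.
Proof.
move=> a0 dl0 hw hb hl.
have loo : l n @[n --> \oo] --> +oo.
  have H n : (a <= n)%N -> l a + dl * (n%:R - a%:R) <= l n.
    elim: n => [|n IH]; first by rewrite leqn0 => /eqP ->; lra.
    rewrite leq_eqVlt => /orP[/eqP -> |]; first by lra.
    rewrite ltnS => hn; have := IH hn; rewrite (hl n hn).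
    have : dl * n.+1%:R >= dl by rewrite ler_peMr ?ler1n // ltW.
    by rewrite -natr1; lra.
  apply/cvgryPge => M; near=> n.
  have hn : (a <= n)%N by near: n; exact: nbhs_infty_ge.
  apply: le_trans (H n hn).
  have : (M - l a) / dl + a%:R <= n%:R by near: n; exact: nbhs_infty_ger.
  by rewrite -lerBrDr ler_pdivrMr //; lra.
pose u s := w s / (s%:R * dl).
(* each [u s] bounds the upper limit from above: Fekete's estimate, summed *)
have ub A : (forall n, (a <= n)%N -> `|A n.+1 - A n - w n.+1| <= b n.+1) ->
    forall s eps, (a <= s)%N -> 0 < eps -> \forall n \near \oo, A n / l n <= u s + eps.
  move=> hA s eps hs e0.
  have [B hB] := subadditive_affine_ub a0 hw hs.
  have e1 : 0 < eps / 2 by lra.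
  have e2 : 0 < eps / 2 * dl / 2 by nra.
  have [n0 _ hn0] : \forall n \near \oo, [/\ (s <= n)%N, B <= eps / 2 * dl / 2 * n%:R
       & b n <= eps / 2 * dl / 2 * n%:R].
    near=> n; split.
    - by near: n; exact: nbhs_infty_ge.
    - have : B / (eps / 2 * dl / 2) <= n%:R by near: n; exact: nbhs_infty_ger.
      by rewrite ler_pdivrMr //; lra.
    - by near: n; exact: hb.
  have {}hn0 n : (n0 <= n)%N -> [/\ (s <= n)%N, B <= eps / 2 * dl / 2 * n%:R
       & b n <= eps / 2 * dl / 2 * n%:R] by exact: hn0.
  have H n : (maxn n0 a <= n)%N -> A n.+1 - A n <= (u s + eps / 2) * (l n.+1 - l n).
    rewrite geq_max => /andP[h1 h2].
    have [h3 h4 h5] := hn0 _ (leqW h1).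
    rewrite (hl n h2).
    have := hB _ h3.
    have -> : w s / s%:R = u s * dl.
      by rewrite /u; field; rewrite pnatr_eq0 -lt0n (leq_trans a0 hs) gt_eqF.
    have := hA _ h2; rewrite ler_norml => /andP[_]; lra.
  have -> : u s + eps = u s + eps / 2 + eps / 2 by lra.
  exact: (stolz_ub _ _ _ _ _ _ H loo e1).
(* a lower bound of all [u s] bounds the increments directly, without Fekete *)
have lb A : (forall n, (a <= n)%N -> `|A n.+1 - A n - w n.+1| <= b n.+1) ->
    forall L eps, (forall s, (a <= s)%N -> L <= u s) -> 0 < eps ->
    \forall n \near \oo, L - eps <= A n / l n.
  move=> hA L eps hL e0.
  have e1 : 0 < eps / 2 by lra.
  have e2 : 0 < eps / 2 * dl by nra.
  have [n0 _ hn0] := hb _ e2.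
  have H n : (maxn n0 a <= n)%N ->
      (- A n.+1) - (- A n) <= (- L + eps / 2) * (l n.+1 - l n).
    rewrite geq_max => /andP[h1 h2].
    have h5 := hn0 _ (leqW h1); rewrite /= in h5.
    rewrite (hl n h2).
    have := hL n.+1 (leqW h2).
    rewrite /u ler_pdivlMr ?mulr_gt0 ?ltr0n //.
    have := hA _ h2; rewrite ler_norml => /andP[+ _]; lra.
  have := stolz_ub _ (fun n => - A n) _ _ _ _ H loo e1.
  apply: filterS => n; rewrite mulNr; lra.
have [[L hL]|hnL] := pselect (exists L, forall s, (a <= s)%N -> L <= u s).
  pose S := [set u s | s in [set s | (a <= s)%N]].
  have hS : has_inf S.
    split; first by exists (u a), a => //=.
    by exists L => _ [s hs <-]; exact: hL.
  exists (expR (inf S)) => A hA.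
  apply: (continuous_cvg _ (@continuous_expR R _)).
  apply/cvgrPdist_le => e e0.
  have e1 : 0 < e / 2 by lra.
  have [_ [s hs <-] hsi] := inf_adherent e1 hS.
  have h1 := ub A hA s _ hs e1.
  have h2 : \forall n \near \oo, inf S - e <= A n / l n.
    apply: lb => // t ht; apply: ge_inf; first by case: hS.
    by exists t.
  near=> n.
  rewrite distrC ler_distl; apply/andP; split; first by near: n.
  apply: le_trans (_ : u s + e / 2 <= _); first by near: n.
  by lra.
exists 0 => A hA; apply: expR_cvg0 => M.
have [s [hs hsM]] : exists s, (a <= s)%N /\ u s < M - 1.
  apply: contrapT => hn; apply: hnL; exists (M - 1) => s hs.
  by rewrite leNgt; apply/negP => h; apply: hn; exists s.
have := ub A hA s 1 hs ltr01; apply: filterS => n; lra.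
Unshelve. all: by end_near. Qed.

Lemma ln_affine_sublinear {R : realType} (C D E F eps : R) :
  0 < eps -> 0 < D -> 0 <= C -> 0 <= E ->
  \forall n \near \oo, C * ln (D * n%:R + E) + F <= eps * n%:R.
Proof.
move=> e0 D0 C0 E0.
pose dt := eps / 2 / (C * D + 1).
have CD : 0 < C * D + 1 by nra.
have dt0 : 0 < dt by rewrite /dt !divr_gt0.
near=> n.
have n0 : 0 < (n%:R : R) by rewrite ltr0n; near: n; exact: nbhs_infty_gt.
have x0 : 0 < D * n%:R + E by nra.
(* from [ln (dt x) < dt x], with [dt] so small that [C dt D <= eps / 2] *)
have lnx : ln (D * n%:R + E) <= dt * (D * n%:R + E) - ln dt.
  rewrite -[ln (D * _ + _)](addrK (ln dt)) -lnM ?posrE // lerB //.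
  rewrite mulrC; apply: ltW; apply: ln_sublinear; exact: mulr_gt0.
have h1 : dt * (C * D) <= eps / 2.
  rewrite /dt mulrAC ler_pdivrMr //; nra.
have h2 : (C * (dt * E - ln dt) + F) / (eps / 2) <= n%:R by near: n; exact: nbhs_infty_ger.
move: h2; rewrite ler_pdivrMr; last by lra.
nra.
Unshelve. all: by end_near. Qed.

Lemma root_cvg0 {R : realType} (M l : nat -> R) :
  (\forall n \near \oo, M n = 0 /\ l n != 0) ->
  (M n `^ (l n)^-1)%:E @[n --> \oo] --> (0 : R)%:E.
Proof.
move=> h; apply: cvg_near_cst; apply: filterS h => n [-> l0].
by rewrite powR0 // invr_neq0.
Qed.

Lemma root_cvg_expR {R : realType} (M l : nat -> R) (c : R) :
  (\forall n \near \oo, 0 < M n) ->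
  expR (ln (M n) / l n) @[n --> \oo] --> c ->
  (M n `^ (l n)^-1)%:E @[n --> \oo] --> c%:E.
Proof.
move=> hM hc; apply: cvg_EFin; first exact: nearW.
apply: cvg_trans hc; apply: near_eq_cvg; apply: filterS hM => n hn /=.
by rewrite /powR gt_eqF // mulrC.
Qed.

(** * Vandermonde determinants and Chebyshev numbers *)

Section Chebyshev.
Context {R : realType} {X : Type} (K : set X) (f : nat -> X -> R[i]).
Local Notation C := R[i].
Local Notation normc := (@ComplexField.Normc.normc R).

Definition vdm (n : nat) (zeta : 'I_n -> X) : C :=
  \det (\matrix_(i < n, j < n) f i (zeta j)).

Definition sup_vdm (n : nat) : R :=
  sup [set complex.Re `|vdm n zeta| | zeta in
        [set zeta : 'I_n -> X | forall j, K (zeta j)]].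

Definition supnorm (g : X -> C) : R := sup [set normc (g z) | z in K].

(** The equality is required on [K] only, so that the notion is insensitive to
    the choice of representatives modulo the ideal of a set containing [K]. *)
Definition monic_on (k : nat) (g : X -> C) : Prop :=
  exists c : nat -> C, forall z, K z -> g z = f k z + \sum_(i < k) c i * f i z.

Definition chebyshev (k : nat) : R := inf [set supnorm g | g in monic_on k].

Definition bounded_on (g : X -> C) : Prop := exists M, forall z, K z -> normc (g z) <= M.

Lemma normc_ge0 (x : C) : 0 <= normc x.
Proof. by case: x => x y; exact: sqrtr_ge0. Qed.

Lemma normc_sum (I : Type) (r : seq I) (F : I -> C) :
  normc (\sum_(i <- r) F i) <= \sum_(i <- r) normc (F i).
Proof.
elim: r => [|x r IH]; first by rewrite !big_nil Normc.normc0.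
rewrite !big_cons; apply: le_trans (le_normcD _ _) _; exact: lerD.
Qed.

Hypothesis K0 : K !=set0.
Hypothesis fK : forall i, bounded_on (f i).

Lemma bounded_onD g h : bounded_on g -> bounded_on h -> bounded_on (fun z => g z + h z).
Proof.
move=> [M hM] [L hL]; exists (M + L) => z Kz.
by apply: le_trans (le_normcD _ _) _; apply: lerD; [exact: hM|exact: hL].
Qed.

Lemma bounded_onM g h : bounded_on g -> bounded_on h -> bounded_on (fun z => g z * h z).
Proof.
move=> [M hM] [L hL]; exists (M * L) => z Kz.
by rewrite Normc.normcM; apply: ler_pM; [exact: normc_ge0..|exact: hM|exact: hL].
Qed.

Lemma bounded_on_cst c : bounded_on (fun=> c).
Proof. by exists (normc c). Qed.

Lemma bounded_on_sum (I : Type) (r : seq I) (F : I -> X -> C) :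
  (forall i, bounded_on (F i)) -> bounded_on (fun z => \sum_(i <- r) F i z).
Proof.
move=> h; elim: r => [|x r IH].
  by exists 0 => z _; rewrite big_nil Normc.normc0.
case: (bounded_onD _ _ (h x) IH) => M hM; exists M => z Kz.
by rewrite big_cons; exact: hM.
Qed.

Lemma monic_bounded k g : monic_on k g -> bounded_on g.
Proof.
move=> [c hc].
have [M hM] : bounded_on (fun z => f k z + \sum_(i < k) c i * f i z).
  apply: bounded_onD; first exact: fK.
  apply: bounded_on_sum => i; apply: bounded_onM; [exact: bounded_on_cst|exact: fK].
by exists M => z Kz; rewrite hc //; exact: hM.
Qed.

Lemma le_supnorm g z : bounded_on g -> K z -> normc (g z) <= supnorm g.
Proof.
move=> [M hM] Kz; apply: sup_upper_bound; last by exists z.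
split; first by exists (normc (g z)), z.
by exists M => _ [w Kw <-]; exact: hM.
Qed.

Lemma supnorm_le g M : (forall z, K z -> normc (g z) <= M) -> supnorm g <= M.
Proof.
move=> hM; apply: ge_sup; first by case: K0 => z Kz; exists (normc (g z)), z.
by move=> _ [z Kz <-]; exact: hM.
Qed.

Lemma supnorm_ge0 g : 0 <= supnorm g.
Proof.
rewrite /supnorm; have [hs|/sup_out -> //] := pselect (has_sup [set normc (g z) | z in K]).
have [z Kz] := K0; apply: le_trans (normc_ge0 (g z)) _.
by apply: sup_upper_bound => //; exists z.
Qed.

Lemma chebyshev_lb k g : monic_on k g -> chebyshev k <= supnorm g.
Proof.
move=> mg; apply: ge_inf; last by exists g.
by exists 0 => _ [h mh <-]; exact: supnorm_ge0.
Qed.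

Lemma le_chebyshev k M :
  (forall g, monic_on k g -> M <= supnorm g) -> M <= chebyshev k.
Proof.
move=> h; apply: lb_le_inf; last by move=> _ [g mg <-]; exact: h.
exists (supnorm (f k)), (f k) => //.
by exists (fun=> 0) => z Kz; rewrite big1 ?addr0 // => i _; rewrite mul0r.
Qed.

Lemma chebyshev_ge0 k : 0 <= chebyshev k.
Proof. by apply: le_chebyshev => g _; exact: supnorm_ge0. Qed.

Lemma cofactor_vdm n (zeta : 'I_n.+1 -> X) (j : 'I_n.+1) :
  normc (cofactor (\matrix_(i < n.+1, j < n.+1) f i (zeta j)) ord_max j)
  = normc (vdm n (fun i => zeta (lift j i))).
Proof.
rewrite /cofactor Normc.normcM.
have -> : normc ((-1) ^+ (@ord_max n + j)) = 1.
  by elim: (_ + _)%N => [|k IH]; rewrite ?expr0 ?Normc.normc1 // exprS Normc.normcM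
    IH mulr1 (normcN (1 : C)) Normc.normc1.
rewrite mul1r; congr (normc (\det _)); apply/matrixP => i k; rewrite !mxE.
by rewrite lift_max.
Qed.

(** Replacing the last row of the matrix by the values of a monic combination
    does not change the determinant: the other rows contribute expansions
    along alien cofactors, which vanish. *)
Lemma vdm_expand_monic n (zeta : 'I_n.+1 -> X) g :
  (forall j, K (zeta j)) -> monic_on n g ->
  vdm n.+1 zeta = \sum_j g (zeta j) *
    cofactor (\matrix_(i < n.+1, j < n.+1) f i (zeta j)) ord_max j.
Proof.
move=> hz [c hc]; set A := \matrix_(_, _) _.
have hA i : \sum_j f (i : 'I_n.+1) (zeta j) * cofactor A ord_max j =
    \det A *+ (i == ord_max).
  have := congr1 (fun M : 'M_n.+1 => M i ord_max) (mul_mx_adj A).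
  by rewrite !mxE => <-; apply: eq_bigr => j _; rewrite !mxE.
under eq_bigr => j _ do rewrite (hc _ (hz j)) mulrDl mulr_suml.
rewrite big_split /= (hA ord_max) eqxx mulr1n exchange_big /= big1 ?addr0 // => i _.
under eq_bigr => j _ do rewrite -mulrA.
rewrite -mulr_sumr (hA (widen_ord (leqnSn n) i)).
have -> : (widen_ord (leqnSn n) i == ord_max) = false.
  by apply/negbTE; rewrite -val_eqE /= neq_ltn ltn_ord.
by rewrite mulr0n mulr0.
Qed.

Lemma normc_vdmS_le n (zeta : 'I_n.+1 -> X) g (B : R) :
  (forall j, K (zeta j)) -> monic_on n g ->
  (forall xi : 'I_n -> X, (forall j, K (xi j)) -> normc (vdm n xi) <= B) ->
  normc (vdm n.+1 zeta) <= n.+1%:R * (supnorm g * B).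
Proof.
move=> hz mg hB; rewrite (vdm_expand_monic _ _ g) //.
apply: le_trans (normc_sum _ _ _) _.
have -> : n.+1%:R * (supnorm g * B) = \sum_(j < n.+1) (supnorm g * B).
  by rewrite sumr_const card_ord mulr_natl.
apply: ler_sum => j _; rewrite Normc.normcM cofactor_vdm.
apply: ler_pM; [exact: normc_ge0|exact: normc_ge0| |exact: hB].
by apply: le_supnorm; first exact: monic_bounded mg.
Qed.

Lemma monic_f k : monic_on k (f k).
Proof. by exists (fun=> 0) => z _; rewrite big1 ?addr0 // => i _; rewrite mul0r. Qed.

Lemma vdm_bounded n : exists B, forall zeta : 'I_n -> X,
  (forall j, K (zeta j)) -> normc (vdm n zeta) <= B.
Proof.
elim: n => [|n [B hB]].
  by exists 1 => zeta _; rewrite /vdm det_mx00 Normc.normc1.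
exists (n.+1%:R * (supnorm (f n) * B)) => zeta hz.
by apply: normc_vdmS_le => //; exact: monic_f.
Qed.

Lemma le_sup_vdm n (zeta : 'I_n -> X) :
  (forall j, K (zeta j)) -> normc (vdm n zeta) <= sup_vdm n.
Proof.
move=> hz; apply: sup_upper_bound; last by exists zeta.
split; first by exists (normc (vdm n zeta)), zeta.
by have [B hB] := vdm_bounded n; exists B => _ [xi hxi <-]; exact: hB.
Qed.

Lemma sup_vdm_le n B : (forall zeta : 'I_n -> X,
  (forall j, K (zeta j)) -> normc (vdm n zeta) <= B) -> sup_vdm n <= B.
Proof.
move=> hB; apply: ge_sup; last by move=> _ [zeta hz <-]; exact: hB.
by have [z Kz] := K0; exists (normc (vdm n (fun=> z))), (fun=> z).
Qed.

Lemma sup_vdm_ge0 n : 0 <= sup_vdm n.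
Proof.
have [z Kz] := K0; apply: le_trans (normc_ge0 (vdm n (fun=> z))) _.
exact: le_sup_vdm.
Qed.

Lemma sup_vdmS_le n : sup_vdm n.+1 <= n.+1%:R * (chebyshev n * sup_vdm n).
Proof.
apply: sup_vdm_le => zeta hz.
have h g : monic_on n g -> normc (vdm n.+1 zeta) <= n.+1%:R * (supnorm g * sup_vdm n).
  by move=> mg; apply: normc_vdmS_le => // xi; exact: le_sup_vdm.
have [W0|/eqP W0] := eqVneq (sup_vdm n) 0.
  by have := h _ (monic_f n); rewrite W0 !mulr0.
have W1 : 0 < sup_vdm n by rewrite lt_neqAle sup_vdm_ge0 eq_sym andbT; apply/eqP.
have c0 : 0 < n.+1%:R * sup_vdm n by rewrite mulr_gt0 ?ltr0n.
rewrite mulrCA -ler_pdivrMr //; apply: le_chebyshev => g /h.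
by rewrite mulrCA -ler_pdivrMr.
Qed.

(** For fixed [zeta] with nonzero determinant, the determinant with one free
    point [z] added, divided by that of [zeta], is a monic combination in
    [z]. *)
Lemma sup_vdmS_ge n : chebyshev n * sup_vdm n <= sup_vdm n.+1.
Proof.
have h (zeta : 'I_n -> X) : (forall j, K (zeta j)) ->
    chebyshev n * normc (vdm n zeta) <= sup_vdm n.+1.
  move=> hz; have [->|nz] := eqVneq (vdm n zeta) 0.
    by rewrite Normc.normc0 mulr0 sup_vdm_ge0.
  have v0 : 0 < normc (vdm n zeta).
    rewrite lt_neqAle normc_ge0 eq_sym andbT; apply: contraNneq nz.
    by move/Normc.eq0_normc => ->.
  rewrite -ler_pdivlMr //.
  pose xi (z : X) (j : 'I_n.+1) := oapp zeta z (unlift ord_max j).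
  pose A z := \matrix_(i < n.+1, j < n.+1) f i (xi z j).
  have [z0 Kz0] := K0.
  pose co i := cofactor (A z0) i ord_max.
  (* the cofactors of the last column do not see the free point *)
  have hco z i : cofactor (A z) i ord_max = co i.
    rewrite /co /cofactor; congr (_ * \det _); apply/matrixP => k l; rewrite !mxE.
    by rewrite /xi liftK.
  have cmax : co ord_max = vdm n zeta.
    rewrite /co /cofactor addnn -signr_odd odd_double expr0 mul1r.
    congr (\det _); apply/matrixP => k l; rewrite !mxE.
    by rewrite /xi liftK lift_max.
  have hxi z : vdm n.+1 (xi z) = \sum_i f (i : 'I_n.+1) z * co i.
    rewrite /vdm (expand_det_col _ ord_max); apply: eq_bigr => i _.
    by rewrite hco mxE /xi unlift_none.
  pose g z := vdm n.+1 (xi z) / vdm n zeta.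
  have mg : monic_on n g.
    exists (fun i => co (inord i) / vdm n zeta) => z Kz.
    rewrite /g hxi big_ord_recr /= cmax mulrDl mulfK // addrC; congr (_ + _).
    rewrite mulr_suml; apply: eq_bigr => i _; rewrite -mulrA [RHS]mulrC.
    congr (_ * (co _ / _)); apply: val_inj; rewrite /= inordK //.
    exact: leqW (ltn_ord i).
  apply: le_trans (chebyshev_lb _ _ mg) _.
  apply: supnorm_le => z Kz; rewrite /g Normc.normcM Normc.normcV.
  rewrite ler_pM2r ?invr_gt0 //; apply: le_sup_vdm => j.
  by rewrite /xi; case: unliftP => [k _|_] /=; [exact: hz|exact: Kz].
have [T0|T0] := eqVneq (chebyshev n) 0; first by rewrite T0 mul0r sup_vdm_ge0.
have T1 : 0 < chebyshev n by rewrite lt_neqAle chebyshev_ge0 eq_sym T0.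
rewrite mulrC -ler_pdivlMr //; apply: sup_vdm_le => zeta hz.
by rewrite ler_pdivlMr // mulrC; exact: h.
Qed.

End Chebyshev.

(** * Dimensions and enumerations *)

Section DimensionFacts.
Context {F : fieldType} {M : lmodType F}.

Lemma has_dim_uniq (W : set M) k k' :
  has_dim_mod W [set 0] k -> has_dim_mod W [set 0] k' -> k = k'.
Proof.
wlog suff h : k k' / has_dim_mod W [set 0] k -> has_dim_mod W [set 0] k' -> (k <= k')%N.
  by move=> h1 h2; apply/eqP; rewrite eqn_leq !h.
move=> [b [Wb fb gb]] [b' [Wb' fb' gb']].
have /choice [A hA] : forall i, exists c : 'I_k' -> F, b i = \sum_j c j *: b' j.
  by move=> i; have [c /eqP] := gb' _ (Wb i); rewrite subr_eq0 => /eqP; exists c.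
have /choice [B hB] : forall i, exists c : 'I_k -> F, b' i = \sum_j c j *: b j.
  by move=> i; have [c /eqP] := gb _ (Wb' i); rewrite subr_eq0 => /eqP; exists c.
apply: (@mulmx1_min F k k' (\matrix_(i, j) A i j) (\matrix_(i, j) B i j)).
apply/matrixP => i l; rewrite !mxE; apply/eqP; rewrite -subr_eq0; apply/eqP.
apply: (fb (fun l => \sum_j (\matrix_(i, j) A i j) i j * (\matrix_(i, j) B i j) j l
  - (i == l)%:R)).
rewrite /=; under eq_bigr => j _ do rewrite scalerBl scaler_suml.
rewrite sumrB exchange_big /=.
rewrite [X in _ - X](_ : _ = b i); last first.
  rewrite (bigD1 i) //= eqxx scale1r big1 ?addr0 // => j ji.
  by rewrite eq_sym (negbTE ji) scale0r.
apply/eqP; rewrite subr_eq0; apply/eqP; rewrite [RHS]hA.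
apply: eq_bigr => j _; rewrite [in RHS]hB scaler_sumr.
by apply: eq_bigr => l' _; rewrite !mxE scalerA.
Qed.

Lemma lin_dimP (W : set M) k : has_dim_mod W [set 0] k -> lin_dim W = k.
Proof.
move=> h; apply: (has_dim_uniq W _ _ _ h).
exact: (xgetI _ h).
Qed.

End DimensionFacts.

Lemma msize_leP {n : nat} {F : fieldType} (p : {mpoly F[n]}) k :
  (msize p <= k)%N <-> (forall m, m \in msupp p -> (mdeg m < k)%N).
Proof.
split=> [h m /msize_mdeg_lt h'|h]; first exact: leq_trans h' h.
by rewrite msizeE; apply/bigmax_leqP_seq => m hm _; exact: h.
Qed.

Lemma lin_dim_monomials {n : nat} {F : fieldType} (W : set {mpoly F[n]}) k
    (be : 'I_k -> 'X_{1..n}) : injective be ->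
  (forall p, W p <-> forall m, m \in msupp p -> exists i, m = be i) ->
  lin_dim W = k.
Proof.
move=> ib hW; apply: lin_dimP; exists (fun i => 'X_[be i]); split.
- by move=> i; apply/hW => m; rewrite msuppX inE => /eqP ->; exists i.
- move=> c hc i; have := congr1 (mcoeff (be i)) hc.
  rewrite mcoeff0 raddf_sum /= (bigD1 i) //= big1 ?addr0.
    by rewrite mcoeffZ mcoeffX eqxx mulr1.
  move=> j ji; rewrite mcoeffZ mcoeffX (inj_eq ib) (negbTE ji) mulr0 //.
- move=> p /hW hp; exists (fun i => p@_(be i)).
  apply/eqP; rewrite subr_eq0; apply/eqP/mpolyP => m; rewrite raddf_sum /=.
  have [/hp [i ->]|hm] := boolP (m \in msupp p).
    rewrite (bigD1 i) //= big1 ?addr0.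
      by rewrite mcoeffZ mcoeffX eqxx mulr1.
    by move=> j ji; rewrite mcoeffZ mcoeffX (inj_eq ib) (negbTE ji) mulr0.
  rewrite (memN_msupp_eq0 hm) big1 // => i _; rewrite mcoeffZ mcoeffX.
  have [bm|] := eqVneq (be i) m; last by rewrite mulr0.
  by rewrite bm (memN_msupp_eq0 hm) mul0r.
Qed.

Lemma increasing_endo_id (d : nat) (f : nat -> nat) :
  (forall j, (j < d)%N -> (f j < d)%N) ->
  (forall i j, (i < j)%N -> (j < d)%N -> (f i < f j)%N) ->
  forall j, (j < d)%N -> f j = j.
Proof.
move=> fd fm.
have lo j : (j < d)%N -> (j <= f j)%N.
  elim: j => // j IH hj; apply: leq_ltn_trans (IH (ltnW hj)) _; exact: fm.
have hi k : (k < d)%N -> (f (d.-1 - k) <= d.-1 - k)%N.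
  elim: k => [|k IH] hk; first by rewrite subn0; have := fd d.-1; lia.
  have := IH (ltnW hk); have := fm (d.-1 - k.+1)%N (d.-1 - k)%N; lia.
move=> j hj; apply/eqP; rewrite eqn_leq lo // andbT.
have := hi (d.-1 - j)%N; rewrite subKn; last by lia.
by move=> H; apply: H; lia.
Qed.

(** Writing [e'] through [e] gives an increasing map of the natural numbers,
    onto since the ranges agree, hence the identity. *)
Lemma listing_unique {T : Type} (lt : T -> T -> Prop) (e e' : nat -> T) :
  (forall x y, lt x y -> ~ lt y x) ->
  (forall i j, (i < j)%N -> lt (e i) (e j)) ->
  (forall i j, (i < j)%N -> lt (e' i) (e' j)) ->
  range e = range e' -> forall i, e i = e' i.
Proof.
move=> asym he he' hr.
have /choice [f hf] : forall i, exists k, e k = e' i.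
  move=> i; have : range e (e' i) by rewrite hr; exists i.
  by case=> k _ h; exists k.
have einj i j : e i = e j -> i = j.
  move=> h; case: (ltngtP i j) => // /he; rewrite h => hh; by case: (asym _ _ hh hh).
have fmono i j : (i < j)%N -> (f i < f j)%N.
  move=> ij; have := he' _ _ ij; rewrite -!hf => h.
  case: (ltngtP (f i) (f j)) => // [/he /asym//|hfe].
  by rewrite hfe in h; case: (asym _ _ h h).
have fge i : (i <= f i)%N.
  by elim: i => // i IH; exact: leq_ltn_trans IH (fmono _ _ (ltnSn i)).
suff fid i : f i = i by move=> i; rewrite -hf fid.
have : range e' (e i) by rewrite -hr; exists i.
case=> j _; rewrite -hf => /einj fj.
elim/ltn_ind: i j fj => i IH j fj.
case: (ltngtP j i) => [ji|ij|ji]; last by rewrite -{1}ji.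
- have : range e' (e j) by rewrite -hr; exists j.
  case=> k _; rewrite -hf => /einj fk.
  by have := IH _ ji _ fk; rewrite fj => ij; move: ji; rewrite ij ltnn.
- by have := fge j; rewrite fj leqNgt ij.
Qed.

(** * The grevlex order and normal forms *)

Section Grevlex.
Context {n : nat}.
Implicit Types m : 'X_{1..n}.

Lemma grevlex_mdeg {m m'} : grevlex m m' -> (mdeg m <= mdeg m')%N.
Proof. by case/orP => [/ltnW|/andP[/eqP -> _]]. Qed.

Lemma grevlex_irr m : grevlex m m = false.
Proof.
apply/negP => /orP[|/andP[_ /existsP[i /andP[]]]]; by rewrite ltnn.
Qed.

Lemma grevlex_trans {m1 m2 m3} : grevlex m1 m2 -> grevlex m2 m3 -> grevlex m1 m3.
Proof.
move=> /orP[h12|/andP[/eqP e12 /existsP[i /andP[i1 /forallP i2]]]].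
  by move/grevlex_mdeg => h; apply/orP; left; exact: leq_trans h12 h.
move=> /orP[h23|/andP[/eqP e23 /existsP[j /andP[j1 /forallP j2]]]].
  by apply/orP; left; rewrite e12.
apply/orP; right; rewrite e12 e23 eqxx /=; apply/existsP.
have i3 (k : 'I_n) : (k < i)%N -> m1 k = m2 k by move=> hk; have /implyP/(_ hk)/eqP := i2 k.
have j3 (k : 'I_n) : (k < j)%N -> m2 k = m3 k by move=> hk; have /implyP/(_ hk)/eqP := j2 k.
case: (ltngtP i j) => [ij|ji|/val_inj ij].
- exists i; rewrite -(j3 _ ij) i1 /=; apply/forallP => k; apply/implyP => hk.
  by rewrite (i3 _ hk) (j3 _ (ltn_trans hk ij)).
- exists j; rewrite (i3 _ ji) j1 /=; apply/forallP => k; apply/implyP => hk.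
  by rewrite (i3 _ (ltn_trans hk ji)) (j3 _ hk).
- exists i; rewrite -{}ij in j1 j3; rewrite (ltn_trans j1 i1) /=.
  by apply/forallP => k; apply/implyP => hk; rewrite (i3 _ hk) (j3 _ hk).
Qed.

Lemma grevlex_asym m m' : grevlex m m' -> ~~ grevlex m' m.
Proof. by move=> h; apply/negP => /(grevlex_trans h); rewrite grevlex_irr. Qed.

Lemma grevlexD2r m0 m m' : grevlex m m' -> grevlex (m + m0)%MM (m' + m0)%MM.
Proof.
rewrite /grevlex !mdegD ltn_add2r eqn_add2r => /orP[->//|/andP[-> /existsP[i hi]]].
apply/orP; right; apply/existsP; exists i; move/andP: hi => [i1 /forallP i2].
rewrite !mnmDE ltn_add2r i1 /=; apply/forallP => k; rewrite !mnmDE eqn_add2r.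
exact: i2.
Qed.

(** There are finitely many monomials of degree at most that of [m0], so the
    number of predecessors among them is a decreasing measure. *)
Lemma grevlex_ind (P : 'X_{1..n} -> Prop) :
  (forall m, (forall m', grevlex m' m -> P m') -> P m) -> forall m, P m.
Proof.
move=> IH m0.
pose k := (mdeg m0).+1.
pose below m := #|[pred x : 'X_{1..n < k} | grevlex x m]|.
have H : forall N m, (mdeg m < k)%N -> (below m < N)%N -> P m.
  elim=> // N IHN m hm hN; apply: IH => m' hm'.
  have hk : (mdeg m' < k)%N := leq_ltn_trans (grevlex_mdeg hm') hm.
  apply: IHN => //; rewrite ltnS in hN; apply: leq_trans hN.
  apply: proper_card; apply/properP; split.
    by apply/fintype.subsetP => x; rewrite !inE => /grevlex_trans; apply.
  by exists (BMultinom hk); rewrite inE /= ?grevlex_irr.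
exact: (H _ m0 (ltnSn _) (ltnSn _)).
Qed.

End Grevlex.

Section NormalForms.
Context {R : realType} {N : nat} (V : set 'rV[R[i]]_N.+1).
Local Notation C := R[i].
Local Notation poly := {mpoly C[N.+1]}.
Implicit Types (p q r : poly) (m : 'X_{1..N.+1}).

Definition eq_on p q : Prop := forall z, V z -> eval_at p z = eval_at q z.

Lemma eval_atD p q z : eval_at (p + q) z = eval_at p z + eval_at q z.
Proof. exact: mevalD. Qed.
Lemma eval_atB p q z : eval_at (p - q) z = eval_at p z - eval_at q z.
Proof. exact: mevalB. Qed.
Lemma eval_atM p q z : eval_at (p * q) z = eval_at p z * eval_at q z.
Proof. exact: mevalM. Qed.
Lemma eval_atZ c p z : eval_at (c *: p) z = c * eval_at p z.
Proof. exact: mevalZ. Qed.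
Lemma eval_at_sum (I : Type) (s : seq I) (F : I -> poly) z :
  eval_at (\sum_(i <- s) F i) z = \sum_(i <- s) eval_at (F i) z.
Proof. by rewrite /eval_at raddf_sum. Qed.

Lemma coord_ring0 : coord_ring V 0.
Proof. by move=> m; rewrite msupp0. Qed.

Lemma coord_ringD p q : coord_ring V p -> coord_ring V q -> coord_ring V (p + q).
Proof.
by move=> hp hq m /msuppD_le; rewrite mem_cat => /orP[/hp|/hq].
Qed.

Lemma coord_ringZ c p : coord_ring V p -> coord_ring V (c *: p).
Proof. by move=> hp m /msuppZ_le /hp. Qed.

Lemma coord_ringB p q : coord_ring V p -> coord_ring V q -> coord_ring V (p - q).
Proof.
by move=> hp hq; apply: coord_ringD => //; rewrite -scaleN1r; exact: coord_ringZ.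
Qed.

Lemma coord_ring_sum (I : Type) (s : seq I) (F : I -> poly) :
  (forall i, coord_ring V (F i)) -> coord_ring V (\sum_(i <- s) F i).
Proof.
move=> h; elim: s => [|x s IH]; first by rewrite big_nil; exact: coord_ring0.
by rewrite big_cons; exact: coord_ringD.
Qed.

Lemma coord_ringX m : std_monomials V m -> coord_ring V 'X_[m].
Proof. by move=> hm m'; rewrite msuppX inE => /eqP ->. Qed.

Lemma std_monomials_div m m' : std_monomials V (m + m')%MM -> std_monomials V m.
Proof.
move=> h [s [hs es]]; apply: h; exists [seq ('X_[m'] * x.1, x.2) | x <- s]; split.
  by move=> _ /mapP[x xs ->]; exact: (hs _ xs).
rewrite big_map mpolyXD es mulr_suml; apply: eq_bigr => x _ /=.
by rewrite -mulrA mulrC.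
Qed.

Lemma coord_ring_div p m : coord_ring V ('X_[m] * p) -> coord_ring V p.
Proof.
move=> h m' hm'; apply: (std_monomials_div _ m); rewrite addmC; apply: h.
by rewrite mcoeff_msupp mulrC mcoeffMX -mcoeff_msupp.
Qed.

Lemma coord_mul_coord p q : coord_ring V (coord_mul V p q).
Proof.
rewrite /coord_mul /normal_form; case: xgetP => [r -> []//|_]; exact: coord_ring0.
Qed.

Definition has_nf (n : nat) p : Prop :=
  exists q, [/\ coord_ring V q, (msize q <= n)%N & eq_on q p].

Lemma has_nf_le n n' p : (n <= n')%N -> has_nf n p -> has_nf n' p.
Proof. by move=> h [q [h1 h2 h3]]; exists q; split => //; exact: leq_trans h. Qed.

Lemma has_nf0 n : has_nf n 0.
Proof. by exists 0; split => //; [exact: coord_ring0|rewrite msize0]. Qed.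

Lemma has_nfD n p q : has_nf n p -> has_nf n q -> has_nf n (p + q).
Proof.
move=> [p' [h1 h2 h3]] [q' [k1 k2 k3]]; exists (p' + q'); split.
- exact: coord_ringD.
- by apply: leq_trans (msizeD_le _ _) _; rewrite geq_max h2.
- by move=> z Vz; rewrite !eval_atD h3 ?k3.
Qed.

Lemma has_nfZ n c p : has_nf n p -> has_nf n (c *: p).
Proof.
move=> [p' [h1 h2 h3]]; exists (c *: p'); split.
- exact: coord_ringZ.
- exact: leq_trans (msizeZ_le _ _) _.
- by move=> z Vz; rewrite !eval_atZ h3.
Qed.

Lemma has_nf_eq n p q : eq_on p q -> has_nf n p -> has_nf n q.
Proof.
by move=> h [r [h1 h2 h3]]; exists r; split => // z Vz; rewrite h3 // h.
Qed.

Lemma has_nf_sum (I : eqType) (s : seq I) (F : I -> poly) n :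
  (forall i, i \in s -> has_nf n (F i)) -> has_nf n (\sum_(i <- s) F i).
Proof.
move=> h; rewrite big_seq; apply: (big_ind (has_nf n)) => //; first exact: has_nf0.
exact: has_nfD.
Qed.

(** A monomial of an ideal generated by monomials is a multiple of one of the
    generators. *)
Lemma lead_idealX m : lead_ideal V 'X_[m] ->
  exists p m0 m1, [/\ vanishing_ideal V p, m0 \in msupp p,
    forall m', m' \in msupp p -> m' != m0 -> grevlex m' m0 & m = (m1 + m0)%MM].
Proof.
move=> [s [hs es]].
have : m \in msupp ('X_[m] : poly) by rewrite msuppX inE.
rewrite es => /msupp_sum_le /flattenP[s' /mapP[x]].
rewrite mem_filter /= => xs -> /msuppM_le /allpairsP[[m1 m2] /= [h1 h2 ->]].
have [p hp [m0 m0p [hlead tE]]] := hs _ xs.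
exists p, m0, m1; split => //; congr (_ + _)%MM.
by move: h2; rewrite tE => /msuppZ_le; rewrite msuppX inE => /eqP.
Qed.

(** The division algorithm: a monomial that is not standard is congruent to a
    combination of smaller ones. *)
Lemma has_nfX m : has_nf (mdeg m).+1 'X_[m].
Proof.
move: m; apply: grevlex_ind => m IH.
have [hm|/contrapT hm] := pselect (std_monomials V m).
  by exists 'X_[m]; split => //; [exact: coord_ringX|rewrite msizeX].
have [p [m0 [m1 [hp m0p hlead mE]]]] := lead_idealX _ hm.
have c0 : p@_m0 != 0 by rewrite -mcoeff_msupp.
(* subtract the multiple of [p] with leading term [X^m] *)
pose q := 'X_[m] - (p@_m0)^-1 *: ('X_[m1] * p).
apply: (has_nf_eq _ q).
  move=> z Vz; rewrite eval_atB eval_atZ eval_atM (hp z Vz).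
  by rewrite !mulr0 subr0.
have -> : q = \sum_(m' <- msupp p) (- ((p@_m0)^-1 * p@_m') *+ (m' != m0)) *: 'X_[(m1 + m')].
  rewrite /q [in X in 'X_[m1] * X](mpolyE p) mulr_sumr scaler_sumr.
  rewrite (bigD1_seq m0) ?msupp_uniq //= [RHS](bigD1_seq m0) ?msupp_uniq //= eqxx.
  rewrite mulr0n scale0r add0r -scalerAr scalerA mulVf // scale1r -mpolyXD mE.
  rewrite opprD addrA subrr add0r -sumrN; apply: eq_bigr => m' m'0.
  by rewrite m'0 mulr1n -scalerAr scalerA -mpolyXD scaleNr.
apply: has_nf_sum => m' hm'; have [->|ne] := eqVneq m' m0.
  by rewrite mulr0n scale0r; exact: has_nf0.
have g : grevlex (m1 + m')%MM m.
  by rewrite mE ![(m1 + _)%MM]addmC; apply: grevlexD2r; exact: hlead.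
apply: has_nfZ; apply: has_nf_le (IH _ g).
by rewrite ltnS; exact: grevlex_mdeg.
Qed.

Lemma has_nf_msize n p : (msize p <= n)%N -> has_nf n p.
Proof.
move/msize_leP => h; rewrite (mpolyE p); apply: has_nf_sum => m /h hm.
by apply: has_nfZ; apply: has_nf_le (has_nfX m).
Qed.

Lemma coord_mulE p q : eq_on (coord_mul V p q) (p * q).
Proof.
have [r [h1 _ h3]] := has_nf_msize _ (p * q) (leqnn _).
rewrite /coord_mul /normal_form; case: xgetP => [r' -> []//|/(_ r) []]; by split.
Qed.

End NormalForms.

(** * The enumeration of the standard monomials *)

Section Listing.
Context {R : realType} {N : nat} (V : set 'rV[R[i]]_N.+1).
Context (alpha : nat -> 'X_{1..N.+1}).
Hypothesis halpha : grevlex_listing V alpha.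
Local Notation C := R[i].

Lemma alpha_std i : std_monomials V (alpha i).
Proof. by case: halpha => <- _; exists i. Qed.

Lemma std_alpha m : std_monomials V m -> exists i, alpha i = m.
Proof. by case: halpha => <- _ [i _ <-]; exists i. Qed.

Lemma alpha_lt i j : (i < j)%N -> grevlex (alpha i) (alpha j).
Proof. by case: halpha => _; apply. Qed.

Lemma alpha_ltE i j : grevlex (alpha i) (alpha j) = (i < j)%N.
Proof.
case: (ltngtP i j) => [/alpha_lt //|/alpha_lt/grevlex_asym/negbTE //|->].
exact: grevlex_irr.
Qed.

Lemma alpha_inj : injective alpha.
Proof.
by move=> i j e; case: (ltngtP i j) => // /alpha_lt; rewrite e grevlex_irr.
Qed.

Lemma alpha_mdeg i j : (i <= j)%N -> (mdeg (alpha i) <= mdeg (alpha j))%N.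
Proof. by rewrite leq_eqVlt => /orP[/eqP -> //|/alpha_lt/grevlex_mdeg]. Qed.

Lemma alpha_unbounded n : exists i, (n < mdeg (alpha i))%N.
Proof.
apply: contrapT => h.
have hn i : (mdeg (alpha i) < n.+1)%N.
  by rewrite ltnS leqNgt; apply/negP => hi; apply: h; exists i.
pose f (i : 'I_#|{: 'X_{1..N.+1 < n.+1}}|.+1) := BMultinom (hn i).
have fi : injective f by move=> i j /(congr1 val) /= /alpha_inj /val_inj.
by have := leq_card f fi; rewrite card_ord ltnn.
Qed.

(** The degree is nondecreasing along the enumeration, so the monomials of
    degree at most [n] form an initial segment; they are a basis of the space
    of dimension [m_ V n]. *)
Lemma ltn_m_ n i : (i < m_ V n)%N = (mdeg (alpha i) <= n)%N.
Proof.
have [k hk kmin] := ex_minnP (alpha_unbounded n).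
have Hk j : (j < k)%N = (mdeg (alpha j) <= n)%N.
  case: ltnP => hj; first by symmetry; rewrite leqNgt; apply/negP => /kmin; rewrite leqNgt hj.
  by symmetry; apply/negbTE; rewrite -ltnNge; apply: leq_trans hk (alpha_mdeg _ _ hj).
suff -> : m_ V n = k by [].
apply: (lin_dim_monomials _ _ (fun i : 'I_k => alpha i)).
  by move=> x y /alpha_inj /val_inj.
move=> p; split=> [[hp /msize_leP hn] m hm|h].
  have [j jE] := std_alpha _ (hp _ hm); have := hn _ hm; rewrite -jE ltnS -Hk => hj.
  by exists (Ordinal hj).
split; first by move=> m /h[j ->]; exact: alpha_std.
by apply/msize_leP => m /h[j ->]; rewrite ltnS -Hk.
Qed.

Lemma m_mono n : (m_ V n <= m_ V n.+1)%N.
Proof.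
rewrite leqNgt; apply/negP; rewrite ltn_m_ => h.
have : (m_ V n.+1 < m_ V n.+1)%N by rewrite ltn_m_; exact: leqW.
by rewrite ltnn.
Qed.

Lemma lin_dim_eq_m_ n : lin_dim (coord_ring_eq V n.+1) = (m_ V n.+1 - m_ V n)%N.
Proof.
apply: (lin_dim_monomials _ _
   (fun i : 'I_(m_ V n.+1 - m_ V n) => alpha (m_ V n + i))).
  by move=> x y /alpha_inj /addnI /val_inj.
have hb i : (mdeg (alpha i) == n.+1) = (m_ V n <= i < m_ V n.+1)%N.
  by rewrite ltn_m_ leqNgt ltn_m_ -ltnNge eqn_leq andbC.
move=> p; split=> [[hp /dhomogP hn] m hm|h].
  have [j jE] := std_alpha _ (hp _ hm); have /eqP := hn _ hm; rewrite -jE hb => /andP[j1 j2].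
  have j3 : (j - m_ V n < m_ V n.+1 - m_ V n)%N by rewrite ltn_sub2r // (leq_ltn_trans j1).
  by exists (Ordinal j3); rewrite /= subnKC.
split; first by move=> m /h[j ->]; exact: alpha_std.
apply/dhomogP => m /h[j ->]; apply/eqP; rewrite hb leq_addr /=.
by rewrite -ltn_subRL.
Qed.

End Listing.

(** * Directional polynomials and standard monomials of high degree *)

Lemma mul_sub_expand (T : comRingType) (x y x' y' w : T) : x * y - w =
  x' * y' - w + (x' * (y - y') + y' * (x - x') + (x - x') * (y - y')).
Proof. by ring. Qed.

Section Directional.
Context {R : realType} {N : nat} (V : set 'rV[R[i]]_N.+1) (d a : nat).
Local Notation C := R[i].
Local Notation poly := {mpoly C[N.+1]}.
Context (lam : 'I_d -> 'rV[C]_N.+1) (v : 'I_d -> poly).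
Context (alpha : nat -> 'X_{1..N.+1}).
Hypothesis hlam : injective lam.
Hypothesis hrange : range lam = points_at_infinity V.
Hypothesis hv : forall j, directional V (lam j) (v j).
Hypothesis ha0 : (0 < a)%N.
Hypothesis hav : forall j, (deg (v j) <= a)%N.
Hypothesis had : forall n, (a <= n)%N -> lin_dim (coord_ring_eq V n) = d.
Hypothesis halpha : grevlex_listing V alpha.
Local Notation z n := ('X_[(U_(ord0) *+ n)%MM] : poly).
Local Notation m0 := (m_ V a.-1).

Lemma m_S n : (a <= n.+1)%N -> m_ V n.+1 = (m_ V n + d)%N.
Proof.
move=> h; have := had _ h; rewrite (lin_dim_eq_m_ _ _ halpha) => <-.
by rewrite subnKC // (m_mono _ _ halpha).
Qed.

Lemma m_block q : m_ V (a.-1 + q) = (m0 + q * d)%N.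
Proof.
elim: q => [|q IH]; first by rewrite addn0 mul0n addn0.
by rewrite addnS m_S ?IH; [rewrite mulSn; lia|lia].
Qed.

Lemma d_gt0 : (0 < d)%N.
Proof.
have [i hi] := alpha_unbounded _ _ halpha a.
have := ltn_m_ V _ halpha (a.-1 + (mdeg (alpha i) - a.-1)) i.
rewrite m_block subnKC; last by lia.
rewrite leqnn; have := ltn_m_ V _ halpha a.-1 i.
case: d => // ; rewrite muln0 addn0 => ->; lia.
Qed.

Lemma mdeg_block q j : (j < d)%N -> mdeg (alpha (m0 + q * d + j)) = (a + q)%N.
Proof.
move=> hj; apply/eqP; rewrite eqn_leq -(ltn_m_ V _ halpha).
have -> : (a + q = a.-1 + q.+1)%N by lia.
rewrite m_block mulSn; apply/andP; split; first by lia.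
by rewrite addnS ltnNge -(ltn_m_ V _ halpha) m_block -leqNgt leq_addr.
Qed.

Lemma block_of_mdeg q i : mdeg (alpha i) = (a + q)%N ->
  exists2 j, (j < d)%N & i = (m0 + q * d + j)%N.
Proof.
move=> h; exists (i - (m0 + q * d))%N.
  have := ltn_m_ V _ halpha (a.-1 + q.+1) i; rewrite m_block h mulSn.
  have := ltn_m_ V _ halpha (a.-1 + q) i; rewrite m_block h.
  lia.
have := ltn_m_ V _ halpha (a.-1 + q) i; rewrite m_block h; lia.
Qed.

Lemma lam0 j : lam j ord0 ord0 = 1.
Proof. by have : points_at_infinity V (lam j); [rewrite -hrange; exists j|case]. Qed.

Lemma eval_v j k : eval_at (v j) (lam k) = (j == k)%:R.
Proof.
have [_ _ h1 h0 _] := hv j.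
have [->|jk] := eqVneq j k; first by have [] := hv k.
apply: h0; first by rewrite -hrange; exists k.
by rewrite (inj_eq hlam) eq_sym.
Qed.

Lemma eval_z n j : eval_at (z n) (lam j) = 1.
Proof.
rewrite /eval_at mevalX big1 // => i _; rewrite mulmnE mnm1E.
by have [<-|_] := eqVneq ord0 i; rewrite ?lam0 ?expr1n // mul0n expr0.
Qed.

Lemma v_neq0 j : v j != 0.
Proof.
apply/eqP => v0; have := eval_v j j.
by rewrite v0 /eval_at meval0 eqxx => /esym/eqP; rewrite oner_eq0.
Qed.

Lemma z1_exp n : ('X_ord0 : poly) ^+ n = z n.
Proof. exact: mpolyXn. Qed.

Lemma zD n n' : z (n + n')%N = z n * z n'.
Proof. by rewrite -!z1_exp exprD. Qed.

Lemma z_homog n : z n \is n.-homog.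
Proof. by rewrite dhomogX /= mdegMn mdeg1 mul1n. Qed.

Lemma v_homog j : v j \is (deg (v j)).-homog.
Proof. by have [] := hv j. Qed.

(** In the defining identity of [v j] both the product and the remainder lie in
    the span of the standard monomials, hence so does the leading term. *)
Lemma coord_z_of_homog p n j : coord_ring V p -> p \is n.-homog ->
  eval_at p (lam j) != 0 -> coord_ring V (z n * v j).
Proof.
move=> hp hn hpj; have [_ _ _ _ /(_ _ hp)[r [hr _]]] := hv j.
have p0 : p != 0 by apply: contraNneq hpj => ->; rewrite /eval_at meval0.
have <- : n = deg p by exact: dhomog_uniq p0 hn (dhomog_msize hn).
have -> : lead_form p = p.
  by rewrite /lead_form pihomog_dE //; exact: dhomog_msize hn.
move=> e; have := coord_ringB _ _ _ (coord_mul_coord V p (v j)) hr.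
rewrite e addrK z1_exp => /(coord_ringZ _ (eval_at p (lam j))^-1).
by rewrite scalerA mulVf // scale1r.
Qed.

(** As the standard monomials are closed under division, large [n] suffice. If
    [v j] has positive degree, [coord_z_of_homog] applied to
    [z ^ (k deg v_j) v_j] gives the multiples of [deg v_j] by induction. If
    [v j] is constant it is 1; a standard monomial of degree [n] does not vanish
    at [lam j], since otherwise it would be congruent to a polynomial of lower
    degree and so be a leading term. *)
Lemma coord_zv n j : coord_ring V (z n * v j).
Proof.
have mono k : (n <= k)%N -> coord_ring V (z k * v j) -> coord_ring V (z n * v j).
  move=> nk; rewrite -(subnK nk) zD -mulrA; exact: coord_ring_div.
have [e0|e0] := posnP (deg (v j)); last first.
  apply: (mono (n * deg (v j))%N); first exact: leq_pmulr.
  elim: n {mono} => [|k IH].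
    by rewrite mul0n mulm0n mpolyX0 mul1r; have [] := hv j.
  rewrite mulSn addnC; apply: coord_z_of_homog IH _ _.
    by apply: dhomogM; [exact: z_homog|exact: v_homog].
  by rewrite eval_atM eval_z eval_v eqxx mulr1 oner_neq0.
(* the remaining case: [v j] is constant *)
have vj1 : v j = 1.
  have /msize_poly1P[c _ vc] : msize (v j) == 1%N.
    have : msize (v j) != 0%N by rewrite msize_poly_eq0 v_neq0.
    by case: (msize (v j)) e0 => [|[]].
  by have := eval_v j j; rewrite vc /eval_at mevalC eqxx => ->.
apply: (mono (a + n)%N); first exact: leq_addl.
set m := alpha (m0 + n * d + j); have hm : mdeg m = (a + n)%N by exact: mdeg_block.
have sm : std_monomials V m by exact: alpha_std.
have cX : coord_ring V 'X_[m] by exact: coord_ringX.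
apply: (coord_z_of_homog 'X_[m]) => //; first by rewrite dhomogX; exact/eqP.
apply/eqP => X0; have [_ _ _ _ /(_ _ cX)[r [hr rn]]] := hv j.
have -> : lead_form ('X_[m] : poly) = 'X_[m].
  by rewrite /lead_form pihomog_dE // dhomogX msizeX.
rewrite X0 scale0r add0r => er.
move: rn; rewrite e0 addn0 msizeX /= => rn.
have mr : m \notin msupp r by exact: msize_mdeg_ge.
case: sm; exists [:: (1, 'X_[m])]; split; last by rewrite big_seq1 mul1r.
move=> x; rewrite inE => /eqP -> /=; exists ('X_[m] - r).
  move=> y Vy; rewrite eval_atB -er (coord_mulE V _ _ _ Vy) vj1 mulr1 subrr //.
have cm : ('X_[m] - r)@_m = 1 by rewrite mcoeffB mcoeffX eqxx (memN_msupp_eq0 mr) subr0.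
exists m; first by rewrite mcoeff_msupp cm oner_neq0.
split; last by rewrite cm scale1r.
move=> m' /msuppB_le; rewrite mem_cat msuppX inE => /orP[/eqP -> /eqP//|].
by move=> /msize_mdeg_lt h _; rewrite /grevlex (leq_trans h rn).
Qed.

Local Notation vs j s := (raise (v j) s).

Lemma raiseE j s : vs j s = z (s - deg (v j)) * v j.
Proof. by rewrite /raise z1_exp. Qed.

Lemma raise_coord j s : coord_ring V (vs j s).
Proof. by rewrite raiseE; exact: coord_zv. Qed.

Lemma raise_homog j s : (a <= s)%N -> vs j s \is s.-homog.
Proof.
move=> hs; rewrite raiseE -[X in X.-homog](@subnK (deg (v j))); last first.
  exact: leq_trans (hav j) hs.
apply: dhomogM; [exact: z_homog|exact: v_homog].
Qed.

Lemma eval_raise j s k : eval_at (vs j s) (lam k) = (j == k)%:R.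
Proof. by rewrite raiseE eval_atM eval_z mul1r eval_v. Qed.

Lemma raise_neq0 j s : vs j s != 0.
Proof.
apply/eqP => v0; have := eval_raise j s j.
by rewrite v0 /eval_at meval0 eqxx => /esym/eqP; rewrite oner_eq0.
Qed.

Lemma deg_raise j s : (a <= s)%N -> deg (vs j s) = s.
Proof.
move=> hs; have h := raise_homog j s hs.
exact: dhomog_uniq (raise_neq0 j s) (dhomog_msize h) h.
Qed.

Lemma msize_raise j s : (a <= s)%N -> msize (vs j s) = s.+1.
Proof. by move=> hs; rewrite (mpolySpred _ (raise_neq0 j s)) deg_raise. Qed.

Lemma raise_add j s t : (a <= s)%N -> vs j (s + t) = z t * vs j s.
Proof.
move=> hs; rewrite !raiseE mulrA -zD addnBA ?(addnC t) //.
exact: leq_trans (hav j) hs.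
Qed.

Definition block_coef q : 'M[C]_d :=
  \matrix_(j, k) (vs j (a + q))@_(alpha (m0 + q * d + k)).

Definition block_eval q : 'M[C]_d :=
  \matrix_(k, j) eval_at 'X_[alpha (m0 + q * d + k)] (lam j).

Lemma raise_block j q :
  vs j (a + q) = \sum_k block_coef q j k *: 'X_[alpha (m0 + q * d + k)].
Proof.
apply/mpolyP => m; rewrite raddf_sum /=.
have inj (k l : 'I_d) : (alpha (m0 + q * d + k) == alpha (m0 + q * d + l)) = (k == l).
  by rewrite (inj_eq (alpha_inj _ _ halpha)) eqn_add2l.
have [hm|hm] := boolP (m \in msupp (vs j (a + q))).
  have [i iE] := std_alpha _ _ halpha _ (raise_coord j _ m hm).
  have /dhomogP/(_ m hm) := raise_homog j (a + q) (leq_addr _ _).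
  rewrite -iE => /block_of_mdeg[k hk ik].
  rewrite ik (bigD1 (Ordinal hk)) //= big1 ?addr0.
    by rewrite mcoeffZ mcoeffX eqxx mulr1 mxE.
  by move=> l lk; rewrite mcoeffZ mcoeffX (inj l (Ordinal hk)) (negbTE lk) mulr0.
rewrite (memN_msupp_eq0 hm) big1 // => k _; rewrite mcoeffZ mcoeffX mxE.
have [bm|] := eqVneq (alpha (m0 + q * d + k)) m; last by rewrite mulr0.
by rewrite bm (memN_msupp_eq0 hm) mul0r.
Qed.

(** Evaluate the expansion of [v_(j,s)] at the points at infinity, where the
    [v_(j,s)] are dual to the [lam k]. *)
Lemma block_coef_eval q : block_coef q *m block_eval q = 1%:M.
Proof.
apply/matrixP => j l; rewrite !mxE -(eval_raise j (a + q) l) raise_block eval_at_sum.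
by apply: eq_bigr => k _; rewrite eval_atZ [X in _ * X]mxE.
Qed.

Lemma monomial_block q (k : 'I_d) :
  'X_[alpha (m0 + q * d + k)] = \sum_j block_eval q k j *: vs j (a + q).
Proof.
under eq_bigr => j _ do rewrite raise_block scaler_sumr.
rewrite exchange_big /=.
under eq_bigr => l _ do under eq_bigr => j _ do rewrite scalerA.
under eq_bigr => l _ do rewrite -scaler_suml.
have E l : \sum_j block_eval q k j * block_coef q j l = (k == l)%:R.
  by have := congr1 (fun A : 'M_d => A k l) (mulmx1C (block_coef_eval q)); rewrite !mxE.
rewrite (bigD1 k) //= E eqxx scale1r big1 ?addr0 // => l lk.
by rewrite E eq_sym (negbTE lk) scale0r.
Qed.

(** By [monomial_block], multiplication by the first variable maps standard
    monomials of degree [a + q] to standard monomials of degree [a + q + 1]; it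
    is increasing and both sets have [d] elements. *)
Lemma alpha_shift q j : (j < d)%N ->
  alpha (m0 + q.+1 * d + j) = (alpha (m0 + q * d + j) + U_(ord0))%MM.
Proof.
have H k : (k < d)%N -> exists l, (l < d)%N /\
    (alpha (m0 + q * d + k) + U_(ord0))%MM = alpha (m0 + q.+1 * d + l).
  move=> hk.
  have : std_monomials V (alpha (m0 + q * d + Ordinal hk) + U_(ord0))%MM.
    have : coord_ring V 'X_[(alpha (m0 + q * d + Ordinal hk) + U_(ord0))%MM].
      rewrite mpolyXD monomial_block mulr_suml; apply: coord_ring_sum => i.
      rewrite -scalerAl mulrC; apply: coord_ringZ.
      rewrite -[X in X * _](_ : z 1 = _); last by rewrite mulm1n.
      by rewrite -raise_add ?leq_addr //; exact: raise_coord.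
    by apply; rewrite msuppX inE.
  move/(std_alpha _ _ halpha) => [i iE].
  have : mdeg (alpha i) = (a + q.+1)%N by rewrite iE mdegD mdeg_block // mdeg1; lia.
  by case/block_of_mdeg => l hl il; exists l; rewrite -il.
(* [H] selects the position in the next block; choice makes it a function *)
pose f k := if pselect (k < d)%N is left h then sval (cid (H k h)) else d.
have fP k : (k < d)%N -> (f k < d)%N /\
    (alpha (m0 + q * d + k) + U_(ord0))%MM = alpha (m0 + q.+1 * d + f k).
  by move=> hk; rewrite /f; case: pselect => // h; case: (cid (H k h)).
move=> hj; have [_ ->] := fP j hj; congr (alpha (_ + _)); apply/esym.
apply: (increasing_endo_id d) hj => [k /fP[]//|k l kl hl].
have [_ e1] := fP k (ltn_trans kl hl); have [_ e2] := fP l hl.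
have : (m0 + q * d + k < m0 + q * d + l)%N by rewrite ltn_add2l.
move/(alpha_lt _ _ halpha)/(grevlexD2r U_(ord0)%MM).
by rewrite e1 e2 (alpha_ltE _ _ halpha) ltn_add2l.
Qed.

Lemma block_coef_const q : block_coef q = block_coef 0.
Proof.
elim: q => [//|q <-]; apply/matrixP => j k; rewrite !mxE addnS -(addn1 (a + q)).
rewrite raise_add ?leq_addr // alpha_shift // mulrC mulm1n.
by rewrite [(_ + U_(ord0))%MM]addmC mcoeffMX.
Qed.

(** * The two bases of the coordinate ring *)

Context (e : nat -> poly).
Hypothesis he : basisC_listing V a v e.

Lemma basisC_lt_asym p q : basisC_lt a v p q -> ~ basisC_lt a v q p.
Proof.
have mX (m m' : 'X_{1..N.+1}) : 'X_[C, m] = 'X_[m'] -> m = m'.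
  move=> h; have : m' \in msupp ('X_[m] : poly) by rewrite h msuppX inE.
  by rewrite msuppX inE => /eqP.
have rX j k s : vs j s = vs k s -> j = k.
  move=> h; apply/eqP; have := eval_raise j s k; rewrite h eval_raise eqxx.
  by case: eqP => // _ /eqP; rewrite oner_eq0.
case=> [h1|[e1 h1]] [h2|[e2 h2]].
- by have := ltn_trans h1 h2; rewrite ltnn.
- by rewrite e2 ltnn in h1.
- by rewrite e1 ltnn in h2.
case: h1 h2 => [[d1 [m1 [m2 [pE qE g1]]]]|[d1 [j [k [pj qk jk]]]]].
  case=> [[_ [m3 [m4 [qE2 pE2]]]]|[d2 _]].
    move: g1; rewrite (mX m1 m4 (etrans (esym pE) pE2)) (mX m2 m3 (etrans (esym qE) qE2)).
    by move=> /grevlex_asym/negP.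
  by move: d2; rewrite e2 leqNgt d1.
case=> [[d2 _]|[_ [j' [k' [qj' pk' jk']]]]]; first by move: d2; rewrite e2 ltnNge d1.
rewrite e2 in qj' pk'.
have E1 : j = k' by apply: (rX _ _ (deg p)); rewrite -pj -pk'.
have E2 : k = j' by apply: (rX _ _ (deg p)); rewrite -qk -qj'.
by move: jk; rewrite E1 E2 => jk; have := ltn_trans jk jk'; rewrite ltnn.
Qed.

(** The basis C listed explicitly: of the position after [m0], the quotient by
    [d] is the degree minus [a] and the remainder is the direction. *)
Let od (i : nat) : 'I_d := Ordinal (ltn_pmod i d_gt0).
Let e' (i : nat) : poly :=
  if (i < m0)%N then 'X_[alpha i] else vs (od (i - m0)) (a + (i - m0) %/ d).

Let e'_block q (j : 'I_d) : e' (m0 + q * d + j) = vs j (a + q).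
Proof.
rewrite /e' ltnNge -addnA leq_addr /= addKn divnMDl ?d_gt0 // (divn_small (ltn_ord j)) addn0.
congr raise; congr v; apply: val_inj; rewrite /= modnMDl modn_small //.
Qed.

Lemma block_index i : (m0 <= i)%N -> exists q (j : 'I_d), i = (m0 + q * d + j)%N.
Proof.
move=> hi; exists ((i - m0) %/ d)%N, (od (i - m0)).
by rewrite /= -addnA -divn_eq subnKC.
Qed.

Let e'_incr i j : (i < j)%N -> basisC_lt a v (e' i) (e' j).
Proof.
have small k : (k < m0)%N -> (mdeg (alpha k) < a)%N.
  by rewrite (ltn_m_ _ _ halpha); lia.
have [hi|/block_index[q [k ->]]] := ltnP i m0; have [hj|/block_index[q' [k' ->]]] := ltnP j m0.
- move=> ij; rewrite /e' hi hj /basisC_lt !msizeX /=.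
  have := alpha_mdeg _ _ halpha _ _ (ltnW ij).
  rewrite leq_eqVlt => /orP[/eqP h|]; last by left.
  right; split => //; left; split; first exact: small.
  by exists (alpha i), (alpha j); split => //; exact: (alpha_lt _ _ halpha).
- move=> _; left; rewrite e'_block deg_raise ?leq_addr // /e' hi msizeX /=.
  by apply: leq_trans (small _ hi) (leq_addr _ _).
- by move=> ij; have := ltn_trans ij hj; rewrite -addnA ltnNge leq_addr.
rewrite !e'_block /basisC_lt !deg_raise ?leq_addr //.
case: (ltngtP q q') => [h _|h|->]; first by left; rewrite ltn_add2l.
  move=> hlt; exfalso.
  have : (q'.+1 * d <= q * d)%N by rewrite leq_mul2r h orbT.
  by rewrite mulSn; have := ltn_ord k'; lia.
rewrite ltn_add2l => kk; right; split => //; right; split => //.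
by exists k, k'.
Qed.

Lemma e_explicit i : e i = e' i.
Proof.
have [hr hlt] := he.
apply: (listing_unique (basisC_lt a v)) => //; first exact: basisC_lt_asym.
rewrite hr; apply/seteqP; split=> p.
  move=> [[m [hm hma] <-]|[j [s [hs ->]]]].
    have [k kE] := std_alpha _ _ halpha _ hm.
    have hk : (k < m0)%N by rewrite (ltn_m_ _ _ halpha) kE; move: hma => /=; lia.
    by exists k => //; rewrite /e' hk kE.
  by exists (m0 + (s - a) * d + j)%N => //; rewrite e'_block subnKC.
move=> [k _ <-]; have [hk|/block_index[q [j ->]]] := ltnP k m0.
  left; exists (alpha k); last by rewrite /e' hk.
  split; first exact: alpha_std.
  by have := hk; rewrite (ltn_m_ _ _ halpha) /=; lia.
by right; exists j, (a + q)%N; rewrite leq_addr e'_block.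
Qed.

Lemma e_small i : (i < m0)%N -> e i = 'X_[alpha i].
Proof. by move=> hi; rewrite e_explicit /e' hi. Qed.

Lemma e_block q (j : 'I_d) : e (m0 + q * d + j) = vs j (a + q).
Proof. by rewrite e_explicit e'_block. Qed.

Lemma e_coord i : coord_ring V (e i).
Proof.
have [hi|/block_index[q [j ->]]] := ltnP i m0; last by rewrite e_block; exact: raise_coord.
by rewrite e_small //; apply: coord_ringX; exact: alpha_std.
Qed.

Lemma msize_e q i : (i < m0 + q * d)%N -> (msize (e i) <= a + q)%N.
Proof.
have [hi _|/block_index[q' [j ->]]] := ltnP i m0.
  by rewrite e_small // msizeX; have := hi; rewrite (ltn_m_ _ _ halpha); lia.
rewrite -addnA ltn_add2l => h; rewrite addnA e_block msize_raise ?leq_addr //.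
have : (q' * d < q * d)%N by apply: leq_ltn_trans h; exact: leq_addr.
by rewrite ltn_mul2r => /andP[_]; lia.
Qed.

Definition transition k : 'M[C]_k := \matrix_(i, j) (e i)@_(alpha j).

(** The transition matrix is block lower triangular; from degree [a] on its
    diagonal blocks are all equal to [block_coef 0]. *)
Lemma det_transition q : \det (transition (m0 + q * d)) = \det (block_coef 0) ^+ q.
Proof.
elim: q => [|q IH].
  rewrite mul0n addn0 expr0 (_ : transition _ = 1%:M) ?det1 //.
  apply/matrixP => i j; rewrite !mxE e_small // mcoeffX.
  by rewrite (inj_eq (alpha_inj _ _ halpha)) val_eqE.
have -> : (m0 + q.+1 * d = m0 + q * d + d)%N by rewrite mulSn; lia.
have -> : transition (m0 + q * d + d) = block_mx (transition (m0 + q * d)) 0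
    (\matrix_(i, j) (e (m0 + q * d + i))@_(alpha j)) (block_coef q).
  apply/matrixP => i j; rewrite !mxE; case: splitP => i' ->; rewrite !mxE;
    case: splitP => j' ->; rewrite !mxE //.
  - apply: memN_msupp_eq0; apply: msize_mdeg_ge.
    by rewrite mdeg_block ?ltn_ord //; exact: msize_e.
  - by rewrite e_block.
by rewrite det_lblock IH block_coef_const -exprSr.
Qed.

Lemma det_block_neq0 : \det (block_coef 0) != 0.
Proof.
apply/eqP => h; have := congr1 determinant (block_coef_eval 0).
by rewrite det_mulmx h mul0r det1 => /esym/eqP; rewrite oner_eq0.
Qed.

Lemma coord_expand q p : coord_ring V p -> (msize p <= a + q)%N ->
  p = \sum_(j < m0 + q * d) p@_(alpha j) *: 'X_[alpha j].
Proof.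
move=> hp /msize_leP hq; apply/mpolyP => m; rewrite raddf_sum /=.
have inj (k l : 'I_(m0 + q * d)) : (alpha k == alpha l) = (k == l).
  by rewrite (inj_eq (alpha_inj _ _ halpha)).
have [hm|hm] := boolP (m \in msupp p).
  have [i iE] := std_alpha _ _ halpha _ (hp m hm).
  have hi : (i < m0 + q * d)%N.
    by rewrite -m_block (ltn_m_ _ _ halpha) iE; have := hq _ hm; lia.
  rewrite -iE (bigD1 (Ordinal hi)) //= big1 ?addr0.
    by rewrite mcoeffZ mcoeffX eqxx mulr1.
  by move=> l lk; rewrite mcoeffZ mcoeffX (inj l (Ordinal hi)) (negbTE lk) mulr0.
rewrite (memN_msupp_eq0 hm) big1 // => k _; rewrite mcoeffZ mcoeffX.
have [bm|] := eqVneq (alpha k) m; last by rewrite mulr0.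
by rewrite bm (memN_msupp_eq0 hm) mul0r.
Qed.

Lemma e_expand q (i : 'I_(m0 + q * d)) :
  e i = \sum_j transition (m0 + q * d) i j *: 'X_[alpha j].
Proof.
rewrite [LHS](coord_expand q) ?msize_e //; last exact: e_coord.
by apply: eq_bigr => j _; rewrite mxE.
Qed.

Lemma e_span q p : coord_ring V p -> (msize p <= a + q)%N ->
  exists c : nat -> C, p = \sum_(i < m0 + q * d) c i *: e i.
Proof.
move=> hp hq; rewrite {1}(coord_expand q p) //.
set k := (m0 + q * d)%N; set P := transition k.
have uP : P \in unitmx.
  by rewrite unitmxE unitfE det_transition expf_neq0 // det_block_neq0.
(* the transition matrix is invertible, by its determinant *)
have aE (j : 'I_k) : 'X_[alpha j] = \sum_i invmx P j i *: e i.
  under eq_bigr => i _ do rewrite (e_expand q i) scaler_sumr.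
  rewrite exchange_big /= (bigD1 j) //= [X in _ + X]big1 ?addr0.
    under eq_bigr => i _ do rewrite scalerA.
    rewrite -scaler_suml; have := congr1 (fun A : 'M_k => A j j) (mulVmx uP).
    by rewrite !mxE eqxx => ->; rewrite scale1r.
  move=> l lj; under eq_bigr => i _ do rewrite scalerA.
  rewrite -scaler_suml; have := congr1 (fun A : 'M_k => A j l) (mulVmx uP).
  by rewrite !mxE eq_sym (negbTE lj) => ->; rewrite scale0r.
pose c (i : 'I_k) := \sum_(j < k) p@_(alpha j) * invmx P j i.
exists (fun i => oapp c 0 (insub i)).
under eq_bigr => j _ do rewrite aE scaler_sumr.
rewrite exchange_big /=; apply: eq_bigr => i _; rewrite valK /= scaler_suml.
by apply: eq_bigr => j _; rewrite scalerA.
Qed.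

Lemma vdm_transition q (zeta : 'I_(m0 + q * d) -> 'rV[C]_N.+1) :
  vdm (fun i x => eval_at (e i) x) (m0 + q * d) zeta =
  \det (block_coef 0) ^+ q * vdm (fun i x => eval_at 'X_[alpha i] x) (m0 + q * d) zeta.
Proof.
rewrite -det_transition -det_mulmx; congr (\det _); apply/matrixP => i j.
rewrite !mxE e_expand eval_at_sum; apply: eq_bigr => k _.
by rewrite eval_atZ !mxE.
Qed.

(** * Multiplication in top degree *)

(** Congruence to 0 modulo the ideal of [V] and polynomials of degree less than
    [s]. *)
Definition low s (p : poly) : Prop := exists r, (msize r <= s)%N /\ eq_on V p r.

Lemma low0 s : low s 0.
Proof. by exists 0; rewrite msize0. Qed.

Lemma lowD s (p q : poly) : low s p -> low s q -> low s (p + q).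
Proof.
move=> [p' [hp ep]] [q' [hq eq]]; exists (p' + q'); split.
  by apply: leq_trans (msizeD_le _ _) _; rewrite geq_max hp.
by move=> y Vy; rewrite !eval_atD ep ?eq.
Qed.

Lemma lowZ s c (p : poly) : low s p -> low s (c *: p).
Proof.
move=> [p' [hp ep]]; exists (c *: p'); split; first exact: leq_trans (msizeZ_le _ _) _.
by move=> y Vy; rewrite !eval_atZ ep.
Qed.

Lemma low_sum s (I : Type) (t : seq I) (F : I -> poly) :
  (forall i, low s (F i)) -> low s (\sum_(i <- t) F i).
Proof.
by move=> h; apply: (big_ind (low s)) => //; [exact: low0|exact: lowD].
Qed.

Lemma low_msize s (p : poly) : (msize p <= s)%N -> low s p.
Proof. by exists p. Qed.

Lemma msizeM_lt (p q : poly) s t : (msize p <= s.+1)%N -> (msize q <= t)%N ->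
  (msize (p * q) <= s + t)%N.
Proof.
move=> hp hq; have [->|p0] := eqVneq p 0; first by rewrite mul0r msize0.
have [->|q0] := eqVneq q 0; first by rewrite mulr0 msize0.
by rewrite msizeM // -subn1 leq_subLR addnA add1n; exact: leq_add.
Qed.

Lemma msize_sum_leq s (I : Type) (t : seq I) (F : I -> poly) :
  (forall i, (msize (F i) <= s)%N) -> (msize (\sum_(i <- t) F i) <= s)%N.
Proof.
move=> h; apply: (big_ind (fun p => (msize p <= s)%N)) => //; first by rewrite msize0.
by move=> p q hp hq; apply: leq_trans (msizeD_le _ _) _; rewrite geq_max hp.
Qed.

(** Write [v_(k,t)] as a power of the first variable times [v k], move that
    power to [v_(i,s)], and use the defining identity of [v k]. *)
Lemma raise_mul i k s t : (a <= s)%N -> (a <= t)%N ->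
  low (s + t) (vs i s * vs k t - (i == k)%:R *: vs k (s + t)).
Proof.
move=> hs ht; have hk := leq_trans (hav k) ht.
have st : (a <= s + (t - deg (v k)))%N := leq_trans hs (leq_addr _ _).
set p := vs i (s + (t - deg (v k))).
have [_ _ _ _ /(_ p (raise_coord _ _))[r [hr rn er]]] := hv k.
exists r; split.
  by move: rn; rewrite deg_raise // -addnA subnK.
have -> : vs i s * vs k t = p * v k.
  by rewrite /p raise_add // (raiseE k t) mulrA [z _ * _]mulrC.
move=> y Vy; have := coord_mulE V p (v k) y Vy; rewrite er.
have -> : lead_form p = p by rewrite /lead_form pihomog_dE // deg_raise //; exact: raise_homog.
rewrite eval_raise deg_raise // z1_exp eval_atB eval_atD => <-.
by rewrite raiseE -addnBA // addrAC subrr add0r.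
Qed.

(** The monic combinations for [v_(j,s)], up to equality on [V]. Since lower
    degree parts are spanned by earlier elements of the basis C, only the
    coefficients in degree [s] are recorded; this makes products easy. *)
Definition monic_top (j : 'I_d) s (p : poly) : Prop :=
  exists c : 'I_d -> C, [/\ c j = 1, forall i : 'I_d, (j < i)%N -> c i = 0 &
    low s (p - \sum_i c i *: vs i s)].

(** The coefficients in top degree multiply componentwise. *)
Lemma monic_topM j s t (p q : poly) : (a <= s)%N -> (a <= t)%N ->
  monic_top j s p -> monic_top j t q -> monic_top j (s + t) (p * q).
Proof.
move=> hs ht [c [cj c0 lp]] [c' [cj' c0' lq]].
exists (fun i => c i * c' i); split; first by rewrite cj cj' mulr1.
  by move=> i hi; rewrite c0 // mul0r.
move: lp lq; set P := \sum_i _ ; set Q := \sum_i _.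
move=> [x [hx ex]] [y [hy ey]].
have szP : (msize P <= s.+1)%N.
  apply: msize_sum_leq => i.
  by apply: leq_trans (msizeZ_le _ _) _; rewrite msize_raise.
have szQ : (msize Q <= t.+1)%N.
  apply: msize_sum_leq => i.
  by apply: leq_trans (msizeZ_le _ _) _; rewrite msize_raise.
have : low (s + t) ((P * Q - \sum_i (c i * c' i) *: vs i (s + t)) + (P * y + Q * x + x * y)).
  apply: lowD; last first.
    apply: lowD; last by apply: low_msize; apply: msizeM_lt => //; exact: leqW.
    apply: lowD; apply: low_msize; first exact: msizeM_lt.
    by rewrite addnC; exact: msizeM_lt.
  have -> : P * Q - \sum_i (c i * c' i) *: vs i (s + t) =
    \sum_i \sum_k (c i * c' k) *: (vs i s * vs k t - (i == k)%:R *: vs k (s + t)).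
    rewrite /P mulr_suml -sumrB; apply: eq_bigr => i _.
    under [RHS]eq_bigr => k _ do rewrite scalerBr.
    rewrite sumrB /Q mulr_sumr; congr (_ - _).
      by apply: eq_bigr => k _; rewrite -scalerAl -scalerAr scalerA.
    rewrite (bigD1 i) //= eqxx scale1r big1 ?addr0 // => k ki.
    by rewrite eq_sym (negbTE ki) scale0r scaler0.
  by apply: low_sum => i; apply: low_sum => k; apply: lowZ; exact: raise_mul.
move=> [r [hr er]]; exists r; split => // u Vu; rewrite -er //.
rewrite eval_atB eval_atD eval_atB !eval_atD !eval_atM.
have -> : eval_at x u = eval_at p u - eval_at P u by rewrite -eval_atB ex.
have -> : eval_at y u = eval_at q u - eval_at Q u by rewrite -eval_atB ey.
exact: mul_sub_expand.
Qed.

Context (K : set 'rV[C]_N.+1).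
Hypothesis KV : K `<=` V.
Local Notation fe := (fun i x => eval_at (e i) x).

Lemma monic_on_top q (j : 'I_d) g : monic_on K fe (m0 + q * d + j) g ->
  exists2 p, monic_top j (a + q) p & forall x, K x -> g x = eval_at p x.
Proof.
move=> [c hc]; set m := (m0 + q * d)%N in hc *.
exists (vs j (a + q) + \sum_(i < m + j) c i *: e i); last first.
  move=> x Kx; rewrite hc // eval_atD eval_at_sum e_block; congr (_ + _).
  by apply: eq_bigr => i _; rewrite eval_atZ.
exists (fun l : 'I_d => if (l < j)%N then c (m + l)%N else (l == j)%:R); split.
- by rewrite ltnn eqxx.
- by move=> i ji; rewrite ltnNge (ltnW ji) /= -val_eqE /= gtn_eqF.
apply: low_msize; rewrite big_split_ord /=.
have -> : \sum_(l < d) (if (l < j)%N then c (m + l)%N else (l == j)%:R) *: vs l (a + q)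
   = vs j (a + q) + \sum_(l < j) c (m + l)%N *: e (m + l)%N.
  rewrite (bigD1 j) //= ltnn eqxx scale1r; congr (_ + _).
  rewrite (big_ord_widen d (fun l => c (m + l)%N *: e (m + l)%N)) ?(ltnW (ltn_ord j)) //.
  rewrite big_mkcond [RHS]big_mkcond; apply: eq_bigr => l _ /=.
  rewrite -val_eqE /=; case: ltngtP => h; rewrite ?scale0r //.
  by rewrite /m e_block.
rewrite opprD addrACA subrr add0r addrK.
apply: msize_sum_leq => i.
by apply: leq_trans (msizeZ_le _ _) _; exact: msize_e.
Qed.

Lemma monic_top_on q (j : 'I_d) p : monic_top j (a + q) p ->
  monic_on K fe (m0 + q * d + j) (eval_at p).
Proof.
move=> [c [cj c0 [r [hr er]]]].
have [r' [r1 r2 r3]] := has_nf_msize V _ _ hr.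
have [b bE] := e_span q r' r1 r2.
set m := (m0 + q * d)%N in bE *.
pose cn k := oapp c 0 (insub k).
have cnE (l : 'I_d) : cn l = c l by rewrite /cn valK.
exists (fun k => if (k < m)%N then b k else cn (k - m)%N) => x Kx.
have Vx := KV x Kx.
have := er x Vx; rewrite -r3 // bE eval_atB => /eqP; rewrite subr_eq => /eqP ->.
rewrite [in RHS]big_split_ord /= addrCA; congr (_ + _).
  by rewrite eval_at_sum; apply: eq_bigr => i _; rewrite eval_atZ ltn_ord.
rewrite eval_at_sum (bigD1 j) //= cj scale1r e_block; congr (_ + _).
rewrite (big_ord_widen d (fun l => (if (m + l < m)%N then b (m + l)%N else
   cn (m + l - m)%N) * eval_at (e (m + l)%N) x)) ?(ltnW (ltn_ord j)) //.
rewrite big_mkcond [RHS]big_mkcond; apply: eq_bigr => l _ /=.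
rewrite -val_eqE /=; case: ltngtP => h //.
  by rewrite eval_atZ ltnNge leq_addr /= addKn cnE /m e_block.
by rewrite c0 // scale0r /eval_at meval0.
Qed.

Hypothesis K0 : K !=set0.
Hypothesis pK : forall p : poly, bounded_on K (eval_at p).
Let fK i : bounded_on K (fe i) := pK (e i).

Lemma chebyshev_submul (j : 'I_d) s t : (a <= s)%N -> (a <= t)%N ->
  (forall k, (m0 <= k)%N -> 0 < chebyshev K fe k) ->
  chebyshev K fe (m0 + (s + t - a) * d + j) <=
  chebyshev K fe (m0 + (s - a) * d + j) * chebyshev K fe (m0 + (t - a) * d + j).
Proof.
move=> hs ht hpos.
have T1 : 0 < chebyshev K fe (m0 + (s - a) * d + j) by apply: hpos; rewrite -addnA leq_addr.
have T2 : 0 < chebyshev K fe (m0 + (t - a) * d + j) by apply: hpos; rewrite -addnA leq_addr.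
rewrite -ler_pdivrMr //; apply: le_chebyshev => // g mg.
have g0 : 0 < supnorm K g by apply: lt_le_trans T1 (chebyshev_lb _ _ K0 _ _ mg).
rewrite ler_pdivrMr // mulrC -ler_pdivrMr //; apply: le_chebyshev => // h mh.
rewrite ler_pdivrMr // mulrC.
have [p pt gp] := monic_on_top _ _ _ mg; have [q qt hq] := monic_on_top _ _ _ mh.
rewrite !subnKC // in pt qt.
have := monic_topM _ _ _ _ _ hs ht pt qt.
rewrite -[X in monic_top _ X](@subnKC a); last exact: leq_trans hs (leq_addr _ _).
move/monic_top_on/(chebyshev_lb _ _ K0 _ _)/le_trans; apply.
apply: supnorm_le => // x Kx; rewrite eval_atM -gp // -hq // Normc.normcM.
have bg := monic_bounded _ _ fK _ _ mg; have bh := monic_bounded _ _ fK _ _ mh.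
by apply: ler_pM; [exact: normc_ge0|exact: normc_ge0| |]; exact: le_supnorm.
Qed.

(** * Convergence of the roots *)

Local Notation W := (sup_vdm K fe).
Local Notation T := (chebyshev K fe).
Local Notation fa := (fun i x => eval_at ('X_[alpha i] : poly) x).
Local Notation delta := (ComplexField.Normc.normc (\det (block_coef 0))).

Lemma norm_det_gt0 : 0 < delta.
Proof.
rewrite lt_neqAle normc_ge0 andbT eq_sym; apply: contraNneq det_block_neq0.
by move/Normc.eq0_normc => ->.
Qed.

Lemma sup_vdm_transition q : W (m0 + q * d) = delta ^+ q * sup_vdm K fa (m0 + q * d).
Proof.
have nX n (x : C) : ComplexField.Normc.normc (x ^+ n) = ComplexField.Normc.normc x ^+ n.
  by elim: n => [|n IH]; rewrite ?expr0 ?Normc.normc1 // !exprS Normc.normcM IH.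
have q0 : 0 < delta ^+ q by rewrite exprn_gt0 // norm_det_gt0.
have faK i : bounded_on K (fa i) by exact: pK.
apply/eqP; rewrite eq_le; apply/andP; split.
  apply: sup_vdm_le => // zeta hz; rewrite vdm_transition Normc.normcM nX.
  by rewrite ler_pM2l //; exact: le_sup_vdm.
rewrite mulrC -ler_pdivlMr //; apply: sup_vdm_le => // zeta hz.
rewrite ler_pdivlMr // mulrC -nX -Normc.normcM -vdm_transition.
exact: le_sup_vdm.
Qed.

Lemma ln_sup_vdm_step k : 0 < W k -> 0 < W k.+1 ->
  0 < T k /\ 0 <= ln (W k.+1) - ln (W k) - ln (T k) <= ln k.+1%:R.
Proof.
move=> W0 W1; have hge := sup_vdmS_ge K fe K0 fK k; have hle := sup_vdmS_le K fe K0 fK k.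
have T0 : 0 < T k.
  rewrite lt_neqAle chebyshev_ge0 // andbT eq_sym; apply/eqP => T0.
  by move: hle; rewrite T0 mul0r mulr0 leNgt W1.
split => //; have n0 : 0 < (k.+1%:R : R) by rewrite ltr0n.
rewrite -addrA -opprD -lnM ?posrE // subr_ge0 lerBlDr.
rewrite -lnM ?posrE ?mulr_gt0 // ?ler_ln ?posrE ?mulr_gt0 // [W k * _]mulrC.
by rewrite hge hle.
Qed.

Lemma ln_sup_vdm_block k M j : (forall i, (m0 <= i)%N -> 0 < W i) ->
  (m0 <= k)%N -> (k + j <= M)%N ->
  `|ln (W (k + j)) - ln (W k) - \sum_(i < j) ln (T (k + i))| <= j%:R * ln M%:R.
Proof.
move=> hW hk; elim: j => [|j IH] hj.
  by rewrite addn0 subrr big_ord0 subr0 normr0 mul0r.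
have kj : (m0 <= k + j)%N := leq_trans hk (leq_addr _ _).
have [_ /andP[h1 h2]] := ln_sup_vdm_step _ (hW _ kj) (hW _ (leqW kj)).
have h3 : ln (k + j).+1%:R <= ln M%:R :> R.
  by rewrite ler_ln ?posrE ?ltr0n ?ler_nat -?addnS //; lia.
have := IH (leq_trans (leq_add (leqnn k) (leqnSn j)) hj).
rewrite big_ord_recr /= addnS -natr1 !ler_norml => /andP[h4 h5]; apply/andP; split; lra.
Qed.

Lemma l_S n : (a <= n)%N -> l_ V n.+1 = (l_ V n + d * n.+1)%N.
Proof.
move=> hn; rewrite /l_ big_nat_recr //=; congr (_ + _)%N.
by rewrite m_S ?leqW // addKn mulnC.
Qed.

Lemma m_blockE n : (a <= n.+1)%N -> m_ V n = (m0 + (n.+1 - a) * d)%N.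
Proof. by move=> hn; rewrite -m_block; congr (m_ V); lia. Qed.

Lemma l_neq0 n : (a < n)%N -> l_ V n != 0%N.
Proof.
case: n => // n hn; rewrite l_S //.
by rewrite addn_eq0 negb_and muln_eq0 negb_or -!lt0n d_gt0 orbT.
Qed.

Lemma m_gt0 n : (a <= n)%N -> (0 < m_ V n)%N.
Proof.
by move=> hn; rewrite m_blockE ?leqW // addn_gt0 muln_gt0 subn_gt0 ltnS hn d_gt0 orbT.
Qed.

(** The increments of [ln W] over one degree and those of its analogue for the
    monomials differ from the subadditive sequence [w] by at most
    [b n = O(ln n)], so that [weighted_fekete] gives them a common limit. *)
Lemma vandermonde_roots_cvg : exists c : R,
  vandermonde_root V e K n @[n --> \oo] --> c%:E /\
  vandermonde_root V (fun i => 'X_[alpha i]) K n @[n --> \oo] --> c%:E.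
Proof.
have maxE n : max_vandermonde V e K n = W (m_ V n) by [].
have maxaE n : max_vandermonde V (fun i => 'X_[alpha i]) K n = sup_vdm K fa (m_ V n) by [].
have W0 k : 0 <= W k by exact: sup_vdm_ge0.
have tr n : (a <= n.+1)%N -> W (m_ V n) = delta ^+ (n.+1 - a) * sup_vdm K fa (m_ V n).
  by move=> hn; rewrite m_blockE // sup_vdm_transition.
have deltaq q : 0 < delta ^+ q by rewrite exprn_gt0 // norm_det_gt0.
have [[k [hk Wk]]|hW] := pselect (exists k, (m0 <= k)%N /\ W k = 0).
  (* a zero propagates upwards, since [W (k + 1)] is at most a multiple of [W k] *)
  have Wz i : W (k + i) = 0.
    elim: i => [|i IH]; first by rewrite addn0.
    apply/eqP; rewrite eq_le W0 andbT addnS; have := sup_vdmS_le K fe K0 fK (k + i).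
    by rewrite IH !mulr0.
  have key : \forall n \near \oo, W (m_ V n) = 0 /\ ((l_ V n)%:R : R) != 0 /\ (a <= n.+1)%N.
    near=> n; have hn : (a + k < n)%N by near: n; exact: nbhs_infty_gt.
    split; last split; last by lia.
      rewrite m_blockE; last by lia.
      have d0 := d_gt0; have : (k <= m0 + (n.+1 - a) * d)%N by nia.
      by move=> /subnKC <-.
    by rewrite pnatr_eq0 l_neq0 //; lia.
  exists 0; split.
    by apply: root_cvg0; apply: filterS key => n [h1 [h2 _]]; rewrite maxE.
  apply: root_cvg0; apply: filterS key => n [h1 [h2 h3]]; split; last exact: h2.
  rewrite maxaE; move: h1; rewrite tr // => /eqP.
  by rewrite mulf_eq0 gt_eqF //= => /eqP.
have {}hW i : (m0 <= i)%N -> 0 < W i.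
  move=> hi; rewrite lt_neqAle W0 andbT eq_sym; apply/eqP => h.
  by apply: hW; exists i.
have Tpos i : (m0 <= i)%N -> 0 < T i.
  by move=> hi; have [] := ln_sup_vdm_step _ (hW _ hi) (hW _ (leqW hi)).
pose w s := \sum_(j < d) ln (T (m0 + (s - a) * d + j)).
pose b n : R := d%:R * ln (d%:R * n%:R + m0%:R) + `|ln delta|.
pose l n : R := (l_ V n)%:R.
have hw s t : (a <= s)%N -> (a <= t)%N -> w (s + t)%N <= w s + w t.
  move=> hs ht; rewrite /w -big_split /=; apply: ler_sum => j _.
  have P q : 0 < T (m0 + q * d + j) by apply: Tpos; rewrite -addnA leq_addr.
  rewrite -lnM ?posrE // ler_ln ?posrE ?mulr_gt0 //; exact: chebyshev_submul.
have hb eps : 0 < eps -> \forall n \near \oo, b n <= eps * n%:R.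
  by move=> e0; apply: ln_affine_sublinear => //; rewrite ?ltr0n ?d_gt0 ?ler0n.
have hl n : (a <= n)%N -> l n.+1 = l n + d%:R * n.+1%:R.
  by move=> hn; rewrite /l l_S // natrD natrM.
have dR : 0 < (d%:R : R) by rewrite ltr0n d_gt0.
have [c hc] := weighted_fekete w b l a d%:R ha0 dR hw hb hl.
pose A n := ln (W (m_ V n)).
(* going from degree [n] to [n + 1] adds one block of [d] basis elements *)
have hA n : (a <= n)%N ->
    `|A n.+1 - A n - w n.+1| <= d%:R * ln (d%:R * n.+1%:R + m0%:R).
  move=> hn; rewrite /A m_S ?leqW //.
  have hmn : m_ V n = (m0 + (n.+1 - a) * d)%N by rewrite m_blockE // leqW.
  have hm : (m0 <= m_ V n)%N by rewrite hmn leq_addr.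
  rewrite -natrM -natrD /w -hmn.
  apply: ln_sup_vdm_block => //.
  by rewrite hmn; nia.
have alE n : (a <= n)%N -> ln (sup_vdm K fa (m_ V n)) = A n - (n.+1 - a)%:R * ln delta.
  move=> hn; rewrite /A tr; last exact: leqW.
  have s0 : 0 < sup_vdm K fa (m_ V n).
    have : 0 < W (m_ V n) by apply: hW; rewrite (m_blockE n) ?leqW // leq_addr.
    by rewrite tr ?leqW // pmulr_rgt0.
  by rewrite lnM ?posrE // lnXn ?norm_det_gt0 // mulr_natl addrAC subrr add0r.
have mge n : (a <= n)%N -> 0 < W (m_ V n).
  by move=> hn; apply: hW; rewrite (m_blockE n) ?leqW // leq_addr.
exists c; split; apply: root_cvg_expR.
- by near=> n; rewrite maxE; apply: mge; near: n; exact: nbhs_infty_ge.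
- apply: (hc A) => n hn; apply: le_trans (hA n hn) _; rewrite lerDl //.
- near=> n; rewrite maxaE -(pmulr_rgt0 _ (deltaq (n.+1 - a)%N)) -tr; last first.
    by apply: leqW; near: n; exact: nbhs_infty_ge.
  by apply: mge; near: n; exact: nbhs_infty_ge.
apply: (hc (fun n => ln (sup_vdm K fa (m_ V n)))) => n hn.
rewrite !alE ?leqW // subSn ?leqW // -natr1.
have := hA n hn; rewrite /b; have := ler_norm (ln delta); have := ler_norm (- ln delta).
rewrite normrN !ler_norml => h1 h2 /andP[h3 h4].
by apply/andP; split; lra.
Unshelve. all: by end_near. Qed.

End Directional.

Lemma normc_continuous {R : realType} :
  continuous (@ComplexField.Normc.normc R : R[i]^o -> R^o).
Proof.
move=> x; apply/(cvgrPdist_le (F := nbhs (x : R[i]^o)) (V := R^o)) => e e0.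
have E0 : 0 < (e%:C)%C :> R[i] by rewrite ltcR.
apply/nbhs_ballP; exists (e%:C)%C => //= y; rewrite -ball_normE /= => h.
(* the norm of [R[i]] takes its values in [R[i]] itself *)
have {}h : ComplexField.Normc.normc (x - y) < e by rewrite -ltcR.
have hn (u w : R[i]) : ComplexField.Normc.normc u - ComplexField.Normc.normc w <= ComplexField.Normc.normc (u - w).
  by rewrite lerBlDr -{1}[u](subrK w); exact: le_normcD.
apply: le_trans (ltW h); rewrite ler_norml; apply/andP; split; last exact: hn.
by rewrite lerNl opprB -[X in _ <= X](normcN (x - y : R[i])) opprB; exact: hn.
Qed.

Lemma compact_coord_bounded {R : realType} {n : nat} (K : set 'rV[R[i]]_n.+1) (i : 'I_n.+1) :
  compact_set K -> bounded_on K (fun z : 'rV[R[i]]_n.+1 => z ord0 i).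
Proof.
move=> hK.
have hc : continuous (fun z : 'rV[R[i]^o]_n.+1 =>
    @ComplexField.Normc.normc R (z ord0 i) : R^o).
  move=> z; apply: (@continuous_comp _ _ _ (fun z : 'rV[R[i]^o]_n.+1 => z ord0 i)
     (@ComplexField.Normc.normc R : R[i]^o -> R^o)).
    exact: coord_continuous.
  exact: normc_continuous.
have hcK := continuous_compact (continuous_subspaceT hc) hK.
have [M [_ /(_ (M + 1))]] := compact_bounded hcK.
rewrite ltrDl ltr01 => /(_ isT) hM; exists (M + 1) => z Kz.
have := hM _ (imageP _ Kz); apply: le_trans; exact: ler_norm.
Qed.

Lemma compact_eval_bounded {R : realType} {n : nat} (K : set 'rV[R[i]]_n.+1)
   (p : {mpoly R[i][n.+1]}) : compact_set K -> bounded_on K (eval_at p).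
Proof.
move=> hK.
have bexp i k : bounded_on K (fun z => z ord0 i ^+ k).
  elim: k => [|k IH]; first exact: bounded_on_cst.
  have [M hM] := bounded_onM K _ _ (compact_coord_bounded K i hK) IH.
  by exists M => z Kz; rewrite exprS; exact: hM.
have bX (m : 'X_{1..n.+1}) (r : seq 'I_n.+1) :
    bounded_on K (fun z => \prod_(i <- r) z ord0 i ^+ m i).
  elim: r => [|i r IH].
    by exists 1 => z _; rewrite big_nil Normc.normc1.
  have [M hM] := bounded_onM K _ _ (bexp i (m i)) IH.
  by exists M => z Kz; rewrite big_cons; exact: hM.
have [M hM] : bounded_on K (fun z => \sum_(m <- msupp p)
    p@_m * \prod_(i <- index_enum 'I_n.+1) z ord0 i ^+ m i).
  by apply: bounded_on_sum => m; apply: bounded_onM; first exact: bounded_on_cst.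
by exists M => z Kz; rewrite /eval_at mevalE; exact: hM.
Qed.

Theorem corollary5p7 (R : realType) (N : nat) (V K : set 'rV[R[i]]_N.+2)
  (d a : nat) (lam : 'I_d -> 'rV[R[i]]_N.+2) (v : 'I_d -> {mpoly R[i][N.+2]})
  (e : nat -> {mpoly R[i][N.+2]}) (alpha : nat -> 'X_{1..N.+2})
  (hV : algebraic_curve V)
  (hi : infinity_not_on_z1 V)
  (hii : smooth_transverse_at_infinity V)
  (hiii : distinct_slopes V)
  (hlam : injective lam) (hrange : range lam = points_at_infinity V)
  (hv : forall j, directional_poly V (lam j) (v j))
  (ha0 : (0 < a)%N) (hav : forall j, (deg (v j) <= a)%N)
  (had : forall n, (a <= n)%N -> lin_dim (coord_ring_eq V n) = d)
  (he : basisC_listing V a v e)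
  (halpha : grevlex_listing V alpha)
  (hK : compact_set K) (hKV : K `<=` V) :
  vandermonde_root V (fun i => 'X_[alpha i]) K n @[n --> \oo] -->
    transfinite_diameter V e K.
Proof.
have hv' j : directional V (lam j) (v j) by case: (hv j).
suff [c [h1 h2]] : exists c : R, vandermonde_root V e K n @[n --> \oo] --> c%:E /\
  vandermonde_root V (fun i => 'X_[alpha i]) K n @[n --> \oo] --> c%:E.
  by rewrite /transfinite_diameter (cvg_limn_einf_sup h1).2.
have [K0|K0] := pselect (K !=set0); last first.
  have z u : vandermonde_root V u K n @[n --> \oo] --> (0 : R)%:E.
    apply: root_cvg0; near=> n.
    have hn : (a < n)%N by near: n; exact: nbhs_infty_gt.
    split; last by rewrite pnatr_eq0; apply: (l_neq0 V d a alpha).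
    rewrite /max_vandermonde (_ : [set _ | _ in _] = set0) ?sup0 //.
    apply/seteqP; split=> // t [zeta hz _]; apply: K0.
    have m0 : (0 < m_ V n)%N by apply: (m_gt0 V d a alpha) => //; exact: ltnW.
    by exists (zeta (Ordinal m0)); exact: hz.
  by exists 0; split; exact: z.
apply: (vandermonde_roots_cvg V d a lam v alpha) => //.
by move=> p; exact: compact_eval_bounded.
Unshelve. all: by end_near. Qed.
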